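(* Let $(M,\omega)$ be a connected symplectic Fréchet manifold endowed with a symplectic action of a Fréchet Lie group $G$ with Lie algebra $\mathfrak g$, having a momentum map $J:M\to\mathfrak g$ with non-equivariance cocycle $\Sigma$ relative to a non-degenerate symmetric pairing $\kappa$ on $\mathfrak g$. Let $j$ be an almost complex structure on $M$ compatible with $\omega$, and let $m\in M$ be a critical point of $\|J\|_\kappa^2$. Assume the following, which are automatic in finite dimensions: $G$ has a smooth exponential map; $G_m$ is a Lie subgroup of $G$; the isotropy representation of $\mathfrak g_m$ on $T_mM$ has a momentum map $\hat J:T_mM\to\mathfrak g_m$; the $\kappa$-adjoints $\operatorname{ad}_\xi^*$ of $\operatorname{ad}_\xi$ exist for all $\xi\in\mathfrak g$; the map $\Sigma_\kappa:\mathfrak g\to\mathfrak g$ with $\kappa(\Sigma_\kappa(\xi),\eta)=\Sigma(\xi,\eta)$ exists. Then for all $\xi,\eta\in\mathfrak g$, $$\tfrac12\operatorname{Hess}_m\|J\|_\kappa^2(\xi\cdot m,\eta\cdot m)=-\kappa\bigl(\xi,Z_m(\operatorname{ad}_{J(m)}+Z_m)\eta\bigr),$$ $$\tfrac12\operatorname{Hess}_m\|J\|_\kappa^2(\xi\cdot m,j(\eta\cdot m))=\kappa\bigl(\xi,(\operatorname{ad}_{J(m)}^*-Z_m)L_m\eta\bigr),$$ $$\tfrac12\operatorname{Hess}_m\|J\|_\kappa^2(j(\xi\cdot m),j(\eta\cdot m))=\kappa\bigl(\xi,(L_m^2-Z_m\operatorname{ad}_{J(m)})\eta\bigr)+\kappa\bigl(T_mJ(j\,\tau_j'(J(m))(\eta\cdot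 m)),\xi\bigr).$$ Equivalently, if $j_m$ is invariant under $J(m)$, the Hessian satisfies $$\tfrac12\operatorname{Hess}_m\|J\|_\kappa^2(\zeta\cdot m,\gamma\cdot m)=\operatorname{Re}\kappa_{\mathbb C}(\zeta,C_m^+R\gamma),\qquad\zeta,\gamma\in\mathfrak g_{\mathbb C},$$ where $$R=\begin{pmatrix}0&-\operatorname{ad}_{J(m)}\\ \operatorname{ad}_{J(m)}+Z_m&L_m\end{pmatrix}=C_m^-\begin{pmatrix}0&0\\ 0&1\end{pmatrix}+\mathrm i\,(\operatorname{ad}_{J(m)}+Z_m).$$ If $J$ is $\operatorname{ad}$-equivariant, then $R=C_m^-\begin{pmatrix}0&0\\ 0&1\end{pmatrix}$.
   Context: Symplectic forms are weak ($\omega$ closed, $X\mapsto\omega_m(X,\cdot)$ injective). $\Upsilon_g:M\to M$ is the (left) action of $g\in G$; $\xi\cdot m=\xi^*(m)=\frac{d}{dt}|_{t=0}\Upsilon_{\exp(t\xi)}(m)$, $\mathfrak g_m=\{\xi:\xi\cdot m=0\}$. A momentum map $J:M\to\mathfrak g$ satisfies $\omega_m(\xi\cdot m,X)+\kappa(T_mJ(X),\xi)=0$. $\Sigma(\xi,\eta)=\kappa(J(m),[\xi,\eta])+\omega_m(\xi\cdot m,\eta\cdot m)$ (independent of $m$). ''$J$ is $\operatorname{ad}$-equivariant'' means $T_mJ(\xi\cdot m)=[\xi,J(m)]$ for all $\xi$, $m$. $\|J\|_\kappa^2(m)=\kappa(J(m),J(m))$; $m$ is critical iff $J(m)\in\mathfrak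 g_m$. The isotropy representation sends $\sigma\in\mathfrak g_m$ to $\tau_m\sigma^*(X)=\frac{d}{dt}|_{t=0}T_m\Upsilon_{\exp(t\sigma)}(X)$ on $T_mM$; its momentum map is given by $\kappa(\hat J(X),\sigma)=\frac12\omega_m(X,\tau_m\sigma^*X)$. $\operatorname{Hess}_mf(X)=\frac{d^2}{dt^2}|_{0}f(\gamma(t))$ for a curve with $\gamma(0)=m,\dot\gamma(0)=X$, and $\operatorname{Hess}_mf(X,Y)$ is its polarization. $j$ is a smooth family of $j_m:T_mM\to T_mM$ with $j_m^2=-\mathrm{id}$, compatible: $\omega(j\cdot,j\cdot)=\omega$, $\omega(X,jX)>0$ for $X\ne0$; not assumed integrable or $G$-invariant. $\tau_j(g)=T\Upsilon_g\circ j\circ T\Upsilon_{g^{-1}}-j$, $\tau_j'(\xi)=\frac{d}{dt}|_0\tau_j(\exp t\xi)$. ''$j_m$ is invariant under $J(m)$'' means $\tau_j'(J(m))_m=0$. Operators on $\mathfrak g$: $L_m\xi=T_mJ(j(\xi\cdot m))$, $Z_m\xi=T_mJ(\xi\cdot m)$. On $\mathfrak g_{\mathbb C}=\mathfrak g\oplus\mathrm i\mathfrak g$: $C_m^\pm=L_m\pm\mathrm iZ_m$ (complex-linear). Real-linear operators on $\mathfrak g_{\mathbb C}$ are written as $2\times2$ matrices: $\begin{pmatrix}T_{11}&T_{12}\\ T_{21}&T_{22}\end{pmatrix}(\xi_1+\mathrm i\xi_2)=T_{11}\xi_1+T_{12}\xi_2+\mathrm i(T_{21}\xi_1+T_{22}\xi_2)$,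 so that $S+\mathrm iT$ corresponds to $\begin{pmatrix}S&-T\\ T&S\end{pmatrix}$. $(\xi_1+\mathrm i\xi_2)\cdot m=\xi_1\cdot m+j(\xi_2\cdot m)$. $\kappa_{\mathbb C}$ is the sesquilinear extension of $\kappa$: $\kappa_{\mathbb C}(\xi_1+\mathrm i\xi_2,\eta_1+\mathrm i\eta_2)=\kappa(\xi_1,\eta_1)+\kappa(\xi_2,\eta_2)+\mathrm i\kappa(\xi_2,\eta_1)-\mathrm i\kappa(\xi_1,\eta_2)$. *)

(* Defs.v *)
From HB Require Import structures.
From mathcomp Require Import all_boot all_order all_algebra.
From mathcomp Require Import all_classical all_reals all_analysis.
From mathcomp Require Import complex.

Set Implicit Arguments.
Unset Strict Implicit.
Unset Printing Implicit Defensive.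

Import Order.TTheory GRing.Theory Num.Theory.
Import numFieldNormedType.Exports.

Local Open Scope classical_set_scope.
Local Open Scope ring_scope.

(** A Hausdorff, first-countable, complete locally convex space.  Cauchy
    sequences are those of the underlying topological group: the uniform
    structure carried by a [tvsType] is only required to induce the topology,
    not to be translation invariant.  In the presence of a countable basis at
    [0], sequential completeness is completeness. *)
Definition frechet_space (R : realType) (E : tvsType R) : Prop :=
  [/\ hausdorff_space E,
      exists2 B : nat -> set E, forall n, nbhs (0 : E) (B n) &
        forall U, nbhs (0 : E) U -> exists n, B n `<=` U &
      forall u : nat -> E,
        (forall U, nbhs (0 : E) U ->
           exists N, forall p q, (N <= p)%N -> (N <= q)%N -> U (u p - u q)) ->
        exists l : E, u @ \oo --> l].

Definition is_dirder (R : realType) (E F : tvsType R) (f : E -> F) (x v : E)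
    (l : F) : Prop :=
  (fun h : R => h^-1 *: (f (x + h *: v) - f x)) @ (0 : R)^' --> l.

Definition dirder (R : realType) (E F : tvsType R) (f : E -> F) (x v : E) : F :=
  xget 0 [set l | is_dirder f x v l].

Definition ddt0 (R : realType) (F : tvsType R) (f : R -> F) : F :=
  @dirder R R^o F f 0 1.

(** Michal-Bastiani (Hamilton) calculus: [f] is [C^n] on the open set [U] if
    it is continuous and, when [n > 0], all its directional derivatives exist on
    [U] and [(x, v) |-> df(x)v] is [C^(n-1)] on [U * E]. *)
Fixpoint Cn_on (R : realType) (n : nat) (E F : tvsType R) (U : set E)
    (f : E -> F) : Prop :=
  (forall x, U x -> {for x, continuous f}) /\
  match n with
  | 0 => True
  | k.+1 => exists df : E -> E -> F,
      (forall x v, U x -> is_dirder f x v (df x v)) /\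
      @Cn_on R k (E * E)%type F [set p | U p.1] (fun p => df p.1 p.2)
  end.

Definition smooth_on (R : realType) (E F : tvsType R) (U : set E)
    (f : E -> F) : Prop := forall n, Cn_on n U f.

Lemma linear_smooth_on (R : realType) (E F : tvsType R) (U : set E)
    (f : E -> F) : linear f -> continuous f -> smooth_on U f.
Proof.
move=> + + n; elim: n E F U f => [|n IHn] E F U f lf cf /=; split=> //.
  by move=> x _; exact: cf.
  by move=> x _; exact: cf.
exists (fun _ v => f v); split.
- move=> x v _; apply: cvg_near_cst; near=> h.
  have h0 : h != 0 by near: h; exact: nbhs_dnbhs_neq.
  by apply/eqP; rewrite [x + _]addrC lf addrK scalerA mulVf// scale1r.
- apply: IHn; first by move=> a p q; rewrite /= lf.
  by move=> p; apply: continuous_comp; [exact: cvg_snd|exact: cf].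
Unshelve. all: by end_near. Qed.

Record chart (R : realType) (M : topologicalType) (E : tvsType R) := Chart {
  cdom : set M;
  cfun :> M -> E;
  cinv : E -> M;
  cdom_open : open cdom;
  ccod_open : open (cfun @` cdom);
  cfun_continuous : forall x, cdom x -> {for x, continuous cfun};
  cinv_continuous : forall y, (cfun @` cdom) y -> {for y, continuous cinv};
  cfunK : forall x, cdom x -> cinv (cfun x) = x
}.

Definition ccod (R : realType) (M : topologicalType) (E : tvsType R)
    (c : chart M E) : set E := c @` cdom c.

Definition smooth_transition (R : realType) (M : topologicalType)
    (E : tvsType R) (c d : chart M E) : Prop :=
  smooth_on (c @` (cdom c `&` cdom d)) (d \o cinv c).

(** [chart_at x] is a preferred chart at [x]; it serves to model the tangent
    space at [x] on the model space, a tangent vector being its coordinate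
    representation in [chart_at x]. *)
Record manifold (R : realType) := Manifold {
  mcarrier :> topologicalType;
  mmodel : tvsType R;
  atlas : set (chart mcarrier mmodel);
  chart_at : mcarrier -> chart mcarrier mmodel;
  chart_at_atlas : forall x, atlas (chart_at x);
  chart_at_dom : forall x, cdom (chart_at x) x;
  atlas_compat : forall c d, atlas c -> atlas d -> smooth_transition c d
}.

Definition frechet_manifold (R : realType) (M : manifold R) : Prop :=
  hausdorff_space M /\ frechet_space (mmodel M).

Definition tangent (R : realType) (M : manifold R) (x : M) : tvsType R :=
  mmodel M.

Section VectorSpaceManifold.
Variables (R : realType) (E : tvsType R).

Let id_open : open (id @` [set: E]).
Proof. by rewrite image_id; exact: openT. Qed.

Let id_continuous_dom (x : E) : [set: E] x -> {for x, continuous (@id E)}.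
Proof. by move=> _; exact: cvg_id. Qed.

Let id_continuous_cod (x : E) :
  (id @` [set: E]) x -> {for x, continuous (@id E)}.
Proof. by move=> _; exact: cvg_id. Qed.

Definition id_chart : chart E E :=
  @Chart R E E setT id id openT id_open id_continuous_dom id_continuous_cod
    (fun _ _ => erefl).

Let id_compat (c d : chart E E) :
  [set id_chart] c -> [set id_chart] d -> smooth_transition c d.
Proof.
move=> -> ->; apply: linear_smooth_on; first by move=> a u v.
by move=> x; exact: cvg_id.
Qed.

(** A locally convex space as a manifold, with the identity as its only chart;
    [tangent (x : vect_manifold E)] is convertible to [E]. *)
Definition vect_manifold : manifold R :=
  @Manifold R E E [set id_chart] (fun _ => id_chart) (fun _ => erefl)
    (fun _ => I) id_compat.

End VectorSpaceManifold.

Definition msmooth_on (R : realType) (M N : manifold R) (U : set M)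
    (f : M -> N) : Prop :=
  (forall x, U x -> {for x, continuous f}) /\
  forall (c : chart M (mmodel M)) (d : chart N (mmodel N)),
    atlas c -> atlas d ->
    smooth_on (c @` (U `&` cdom c `&` f @^-1` cdom d)) (d \o f \o cinv c).

Definition msmooth (R : realType) (M N : manifold R) (f : M -> N) : Prop :=
  msmooth_on setT f.

(** Smoothness of [f : M * N -> P], the product being given the product charts. *)
Definition msmooth2 (R : realType) (M N P : manifold R) (f : M -> N -> P) :
    Prop :=
  continuous (fun p : M * N => f p.1 p.2) /\
  forall (c : chart M (mmodel M)) (d : chart N (mmodel N))
         (e : chart P (mmodel P)),
    atlas c -> atlas d -> atlas e ->
    @smooth_on R (mmodel M * mmodel N)%type (mmodel P)
      [set p | ccod c p.1 /\ ccod d p.2 /\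
               cdom e (f (cinv c p.1) (cinv d p.2))]
      (fun p => e (f (cinv c p.1) (cinv d p.2))).

(** The tangent map [T_x f], read in the preferred charts at [x] and [f x]. *)
Definition mderiv (R : realType) (M N : manifold R) (f : M -> N) (x : M) :
    tangent x -> tangent (f x) :=
  dirder (chart_at (f x) \o f \o cinv (chart_at x)) (chart_at x x).
Arguments mderiv {R} M N f x.

Definition velocity0 (R : realType) (M : manifold R) (g : R -> M) :
    tangent (g 0) :=
  mderiv (vect_manifold R^o) M g 0 1.

(** Independence of the curve, hence existence of [h], holds at critical points
    of [f]; elsewhere [hess] is a junk value. *)
Definition is_hess (R : realType) (M : manifold R) (f : M -> R) (x : M)
    (X : tangent x) (h : R) : Prop :=
  forall g : R -> M,
    (exists2 e : R, 0 < e &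
       @msmooth_on R (vect_manifold R^o) M [set t : R | `|t| < e] g) ->
    g 0 = x -> velocity0 g = X ->
    derive1n 2 (f \o g : R -> R^o) 0 = h.

Definition hess (R : realType) (M : manifold R) (f : M -> R) (x : M)
    (X : tangent x) : R := xget 0 [set h | is_hess f X h].

Definition hess2 (R : realType) (M : manifold R) (f : M -> R) (x : M)
    (X Y : tangent x) : R :=
  (hess f (X + Y) - hess f X - hess f Y) / 2.

Definition critical (R : realType) (M : manifold R) (f : M -> R) (x : M) :
    Prop :=
  forall X : tangent x, mderiv M (vect_manifold R^o) f x X = 0.

Definition two_tensor (R : realType) (M : manifold R) :=
  forall x : M, tangent x -> tangent x -> R.

Definition tensor_in_chart (R : realType) (M : manifold R) (w : two_tensor M)
    (c : chart M (mmodel M)) (y u v : mmodel M) : R^o :=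
  w (cinv c y) (mderiv (vect_manifold (mmodel M)) M (cinv c) y u)
               (mderiv (vect_manifold (mmodel M)) M (cinv c) y v).

Record symplectic_form (R : realType) (M : manifold R) (w : two_tensor M) :
    Prop := SymplecticForm {
  form_linear : forall x (Y : tangent x), scalar (fun X => w x X Y);
  form_alternating : forall x X, w x X X = 0;
  form_smooth : forall c : chart M (mmodel M), atlas c ->
    @smooth_on R (mmodel M * (mmodel M * mmodel M))%type R^o
      [set p | ccod c p.1]
      (fun p => tensor_in_chart w c p.1 p.2.1 p.2.2);
  form_closed : forall c : chart M (mmodel M), atlas c ->
    forall y u1 u2 u3, ccod c y ->
      dirder (fun z => tensor_in_chart w c z u2 u3) y u1
      + dirder (fun z => tensor_in_chart w c z u3 u1) y u2
      + dirder (fun z => tensor_in_chart w c z u1 u2) y u3 = 0;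
  form_nondeg : forall x (X : tangent x), (forall Y, w x X Y = 0) -> X = 0
}.

Definition endo_field (R : realType) (M : manifold R) :=
  forall x : M, tangent x -> tangent x.

Record almost_complex (R : realType) (M : manifold R) (j : endo_field M) :
    Prop := AlmostComplex {
  ac_linear : forall x, linear (j x);
  ac_square : forall x X, j x (j x X) = - X;
  ac_smooth : forall c : chart M (mmodel M), atlas c ->
    @smooth_on R (mmodel M * mmodel M)%type (mmodel M)
      [set p | ccod c p.1]
      (fun p => mderiv M (vect_manifold (mmodel M)) c (cinv c p.1)
         (j (cinv c p.1)
            (mderiv (vect_manifold (mmodel M)) M (cinv c) p.1 p.2)))
}.

Definition compatible (R : realType) (M : manifold R) (w : two_tensor M)
    (j : endo_field M) : Prop :=
  (forall x X Y, w x (j x X) (j x Y) = w x X Y) /\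
  (forall x X, X != 0 -> 0 < w x X (j x X)).

Record lie_group (R : realType) := LieGroup {
  lg_manifold :> manifold R;
  lg_one : lg_manifold;
  lg_mul : lg_manifold -> lg_manifold -> lg_manifold;
  lg_inv : lg_manifold -> lg_manifold;
  lg_mulA : associative lg_mul;
  lg_mul1 : left_id lg_one lg_mul;
  lg_mulV : left_inverse lg_one lg_inv lg_mul;
  lg_mul_smooth : msmooth2 lg_mul;
  lg_inv_smooth : msmooth lg_inv
}.

Definition lie_algebra (R : realType) (G : lie_group R) : tvsType R :=
  tangent (lg_one G).

Definition Ad (R : realType) (G : lie_group R) (g : G) :
    lie_algebra G -> lie_algebra G :=
  mderiv G G (fun h => lg_mul (lg_mul g h) (lg_inv g)) (lg_one G).

(** [[xi, eta] = ad_xi eta], the derivative of [g |-> Ad_g eta] at the identity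
    along [xi]; this is the bracket of left-invariant vector fields. *)
Definition ad (R : realType) (G : lie_group R) (xi eta : lie_algebra G) :
    lie_algebra G :=
  mderiv G (vect_manifold (lie_algebra G)) (fun g => Ad g eta) (lg_one G) xi.

Definition smooth_exponential (R : realType) (G : lie_group R)
    (expG : lie_algebra G -> G) : Prop :=
  [/\ @msmooth R (vect_manifold (lie_algebra G)) G expG,
      forall xi (s t : R),
        expG ((s + t) *: xi) = lg_mul (expG (s *: xi)) (expG (t *: xi)) &
      forall xi, velocity0 (fun t => expG (t *: xi)) = xi].

(** A subgroup which is a (not necessarily split) submanifold: near each of its
    points it is, in a suitable chart, a closed linear subspace of the model. *)
Definition lie_subgroup (R : realType) (G : lie_group R) (H : set G) : Prop :=
  [/\ H (lg_one G),
      forall g h, H g -> H h -> H (lg_mul g h),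
      forall g, H g -> H (lg_inv g) &
      forall h, H h -> exists (c : chart G (mmodel G)) (F : set (mmodel G)),
        [/\ cdom c h,
            forall d, atlas d -> smooth_transition c d /\ smooth_transition d c,
            closed F,
            F 0 /\ (forall (a : R) u v, F u -> F v -> F (a *: u + v)) &
            c @` (cdom c `&` H) = ccod c `&` F]].

Section Action.
Variables (R : realType) (G : lie_group R) (M : manifold R).
Variables (act : G -> M -> M) (expG : lie_algebra G -> G).
Implicit Types (xi eta : lie_algebra G) (x : M).

Definition smooth_action : Prop :=
  [/\ forall x, act (lg_one G) x = x,
      forall g h x, act (lg_mul g h) x = act g (act h x) &
      msmooth2 act].

Definition symplectic_action (w : two_tensor M) : Prop :=
  smooth_action /\
  forall g x (X Y : tangent x),
    w (act g x) (mderiv M M (act g) x X) (mderiv M M (act g) x Y) = w x X Y.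

(** [xi . x].  The velocity lives in the tangent space at [act (expG (0 *: xi)) x],
    which is [x]. *)
Definition fund xi x : tangent x :=
  velocity0 (fun t => act (expG (t *: xi)) x).

Definition stabilizer x : set G := [set g | act g x = x].

Definition stab_algebra x : set (lie_algebra G) := [set xi | fund xi x = 0].

(** [tau_x sigma^*]; meaningful for [sigma] in [stab_algebra x], when all the
    vectors being differentiated are tangent at [x]. *)
Definition isotropy_rep x (sigma : lie_algebra G) (X : tangent x) : tangent x :=
  ddt0 (fun t => mderiv M M (act (expG (t *: sigma))) x X : tangent x).

Definition tau_acs (j : endo_field M) (g : G) : endo_field M := fun x X =>
  (mderiv M M (act g) (act (lg_inv g) x)
     (j (act (lg_inv g) x) (mderiv M M (act (lg_inv g)) x X)) : tangent x)
  - j x X.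

Definition tau_acs' (j : endo_field M) xi : endo_field M := fun x X =>
  ddt0 (fun t => tau_acs j (expG (t *: xi)) X).

Definition pairing (kappa : lie_algebra G -> lie_algebra G -> R) : Prop :=
  [/\ forall eta, scalar (kappa ^~ eta),
      forall xi eta, kappa xi eta = kappa eta xi,
      continuous (fun p : lie_algebra G * lie_algebra G => kappa p.1 p.2) &
      forall xi, (forall eta, kappa xi eta = 0) -> xi = 0].

Variables (w : two_tensor M) (kappa : lie_algebra G -> lie_algebra G -> R).
Variable J : M -> lie_algebra G.

Definition TJ x : tangent x -> lie_algebra G :=
  mderiv M (vect_manifold (lie_algebra G)) J x.

Definition momentum_map : Prop :=
  @msmooth R M (vect_manifold (lie_algebra G)) J /\
  forall xi x (X : tangent x), @w x (fund xi x) X + kappa (TJ X) xi = 0.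

(** The non-equivariance cocycle, computed at [x] (the value does not depend on
    [x] when [M] is connected). *)
Definition cocycle x xi eta : R :=
  kappa (J x) (ad xi eta) + @w x (fund xi x) (fund eta x).

Definition ad_equivariant : Prop := forall xi x, TJ (fund xi x) = ad xi (J x).

Definition normsq x : R := kappa (J x) (J x).

Definition isotropy_momentum_map x
    (Jhat : tangent x -> lie_algebra G) : Prop :=
  [/\ smooth_on setT Jhat,
      forall X, stab_algebra x (Jhat X) &
      forall X sigma, stab_algebra x sigma ->
        kappa (Jhat X) sigma = 2^-1 * @w x X (isotropy_rep sigma X)].

Definition ad_adjoint (adstar : lie_algebra G -> lie_algebra G -> lie_algebra G)
    : Prop :=
  forall xi eta zeta, kappa (adstar xi eta) zeta = kappa eta (ad xi zeta).

Variable j : endo_field M.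

Definition Lop x xi : lie_algebra G := TJ (@j x (fund xi x)).

Definition Zop x xi : lie_algebra G := TJ (fund xi x).

(** [(xi1 + i xi2) . x], with [xi1 + i xi2] encoded as the pair [(xi1, xi2)]. *)
Definition cfund (zeta : lie_algebra G * lie_algebra G) x : tangent x :=
  fund zeta.1 x + @j x (fund zeta.2 x).

End Action.

(** The complexification of [V] is [V * V], [(v1, v2)] standing for [v1 + i v2]. *)
Section Complexification.
Variables (R : realType) (V : tvsType R).
Implicit Types (S : V -> V) (z : V * V).

Definition opmx T11 T12 T21 T22 z : V * V :=
  (T11 z.1 + T12 z.2, T21 z.1 + T22 z.2) : V * V.

Definition op0 : V -> V := fun _ => 0.

Definition cext S : V * V -> V * V := opmx S op0 op0 S.

Definition imul z : V * V := (- z.2, z.1).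

Definition Cplus (L Z : V -> V) z : V * V := cext L z + imul (cext Z z).

Definition Cminus (L Z : V -> V) z : V * V := cext L z - imul (cext Z z).

Definition csesqui (kappa : V -> V -> R) (z y : V * V) : R[i] :=
  ((kappa z.1 y.1 + kappa z.2 y.2) +i* (kappa z.2 y.1 - kappa z.1 y.2))%C.

End Complexification.

(* Main.v *)
From HB Require Import structures.
Require Import Defs.
From mathcomp Require Import all_boot all_order all_algebra.
From mathcomp Require Import all_classical all_reals all_analysis.
From mathcomp Require Import complex.
From mathcomp Require Import ring lra.

(** Put [sigma := J m].  Criticality of [m] and non-degeneracy of [w] give
    [sigma . m = 0], so [exp (t sigma)] fixes [m] and acts on [T_m M]; let [tau]
    be the derivative of this isotropy action, which by symmetry of second
    derivatives is also the derivative at its zero [m] of the fundamental vector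
    field of [sigma].  Differentiating [kappa (J _, J _)] twice along a curve and
    using [d kappa (J _, sigma) = - w (sigma . _, -)] yields
      [Hess (X, Y) / 2 = kappa (TJ X, TJ Y) - w (tau X, Y)],
    where [w (tau X, Y)] is minus the second derivative of [kappa (J _, sigma)],
    hence symmetric.  The three formulas then follow from
    [tau (xi . m) = [sigma, xi] . m] and [tau' = tau j - j tau], and the
    statement on [g_C] by bilinearity.  The last claim uses antisymmetry of the
    bracket, which comes from [Ad_(exp (t xi)) xi = xi].

    On locally convex spaces the calculus rests on a mean value theorem in convex
    open sets, which gives strict differentiability of [C^1] maps, hence the
    chain rule, linearity of derivatives and their symmetry. *)

Set Implicit Arguments.
Unset Strict Implicit.
Unset Printing Implicit Defensive.

Import Order.TTheory GRing.Theory Num.Theory.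
Import numFieldNormedType.Exports.

Local Open Scope classical_set_scope.
Local Open Scope ring_scope.

(** * Calculus in locally convex spaces *)

(** Three obstacles shape the proof. A tangent vector is its coordinate vector in the preferred
    chart at its foot point, and that chart may jump from point to point; so everything near [m] is
    read in the single chart at [m], where the fundamental field of [sigma] becomes a map of the
    model space. There are no norms and no uniqueness of integral curves to rely on: strict
    differentiability is stated along an arbitrary filter, with moving base point and direction, and
    a vanishing velocity is integrated by the mean value theorem. Finally, [w] is given as linear in
    its first argument only; sums in the second one are handled by the momentum equation, which
    makes w (xi . m, -) linear, and by the symmetry of w (tau -, -).

    In terms of [kappa], the momentum equation and compatibility say that [Z] is skew and [L]
    symmetric. The second formula carries [adstar] because there [tau] acts on the vector without
    [j]. If tau' = 0 then [tau] commutes with [j m], and [adstar (J m)] composed with [L] becomes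
    minus [L] composed with ad_(J m); this identity turns the three formulas into the product of C+
    and R. *)

Section MeanValue.
Variables (R : realType).

Definition convex_subset (E : lmodType R) (W : set E) : Prop :=
  forall x y (s : R), 0 <= s -> s <= 1 -> W x -> W y ->
    W (s *: x + (1 - s) *: y).

Lemma convex_nbhs (E : tvsType R) (x : E) (U : set E) : nbhs x U ->
  exists W : set E, [/\ open W, W x, W `<=` U & convex_subset W].
Proof.
move=> xU; have [B Bconvex [Bopen Bnbhs]] := @locally_convex R E.
have [W [BW Wx] WU] := Bnbhs x U xU.
exists W; split=> //; first exact: Bopen.
move=> a b s s0 s1 Wa Wb.
have s01 : (0 <= s <= 1) by rewrite s0.
have := Bconvex W (mem_set BW) a b (Itv01 s0 s1) (mem_set Wa) (mem_set Wb).
rewrite inE /conv/=; by [].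
Qed.

Definition deriv_at (F : tvsType R) (c : R -> F) (s : R) (l : F) : Prop :=
  (fun h : R => h^-1 *: (c (s + h) - c s)) @ (0 : R)^' --> l.

(** The slope over a union of two adjacent intervals is a convex combination of their slopes, and by
    openness of [W] slopes between a point and all nearby points lie in [W]. A supremum argument
    then propagates membership of the slope from [a] to [b]; no functionals are involved, and the
    slope lies in [W] itself, not only in its closure. *)
Lemma mean_value (F : tvsType R) (c : R -> F) (W : set F) (a b : R) :
  open W -> convex_subset W -> a < b ->
  (forall s, a <= s <= b -> exists2 l, W l & deriv_at c s l) ->
  W ((b - a)^-1 *: (c b - c a)).
Proof.
move=> oW cW ab dc.
pose avg s t := (t - s)^-1 *: (c t - c s).
have avg_cat s t u : s < t -> t < u -> W (avg s t) -> W (avg t u) -> W (avg s u).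
  move=> st tu Wst Wtu.
  have su := lt_trans st tu.
  have : W (((t - s) / (u - s)) *: avg s t + (1 - (t - s) / (u - s)) *: avg t u).
    apply: cW => //; first by rewrite divr_ge0// subr_ge0 ltW.
    by rewrite ler_pdivrMr ?subr_gt0// mul1r lerB// ltW.
  rewrite /avg !scalerA.
  have -> : (t - s) / (u - s) * (t - s)^-1 = (u - s)^-1.
    by rewrite mulrAC mulfV ?mul1r// subr_eq0 gt_eqF.
  have -> : (1 - (t - s) / (u - s)) * (u - t)^-1 = (u - s)^-1.
    by field; rewrite !subr_eq0 !gt_eqF.
  by rewrite -scalerDr [c t - _]addrC addrACA subrr addr0 addrC.
have avgC s t : avg s t = avg t s.
  by rewrite /avg -(opprB (c s)) scalerN -scaleNr -invrN opprB.
have loc s : a <= s <= b -> exists2 d : R, 0 < d &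
    forall t, t != s -> `|t - s| < d -> W (avg s t).
  move=> /dc[l Wl /(_ W)]; have Wnl : nbhs l W by exact: open_nbhs_nbhs.
  move=> /(_ Wnl) /nbhs_ballP[d /= d0 dW]; exists d => // t ts tsd.
  have := dW (t - s); rewrite /ball/= sub0r normrN subr_eq0 => /(_ tsd ts).
  by rewrite [s + _]addrC subrK.
(* The case [t = a] is listed apart because [avg a a] is 0, which [W] need not contain. *)
pose S := [set t | a <= t <= b /\ (t = a \/ W (avg a t))].
have Sa : S a by split; [rewrite lexx ltW | left].
have Sub : has_ubound S by exists b => t [/andP[]].
have supS : has_sup S by split; [exists a|].
have aT : a <= sup S by apply: ub_le_sup.
have Tb : sup S <= b by apply: sup_le_ub; [exists a|move=> t [/andP[]]].
have [d d0 dW] : exists2 d : R, 0 < d &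
    forall t, t != sup S -> `|t - sup S| < d -> W (avg (sup S) t).
  by apply: loc; rewrite aT.
have [s Ss Ts] := sup_adherent d0 supS.
have sT : s <= sup S by exact: ub_le_sup.
have ST : sup S = a \/ W (avg a (sup S)).
  move: sT; rewrite le_eqVlt => /predU1P[<-|sT]; first by case: Ss.
  have WsT : W (avg s (sup S)).
    rewrite avgC; apply: dW; first by rewrite lt_eqF.
    by rewrite ltr_norml; apply/andP; split; lra.
  case: Ss => /andP[a_s _] [sa|Was]; first by right; rewrite -sa.
  move: a_s; rewrite le_eqVlt => /predU1P[->|a_s]; first by right.
  by right; apply: avg_cat WsT.
move: Tb; rewrite le_eqVlt => /predU1P[Tb|Tb].
  by case: ST; rewrite Tb // => ba; rewrite ba ltxx in ab.
(* A point beyond [sup S], still in the interval and within reach of the local slope bound; it lands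
   in [S], a contradiction. *)
pose u := Num.min b (sup S + d / 2).
have uT : sup S < u by rewrite lt_min Tb ltrDl divr_gt0.
have WTu : W (avg (sup S) u).
  apply: dW; first by rewrite gt_eqF.
  rewrite gtr0_norm ?subr_gt0// ltrBlDl.
  apply: le_lt_trans (_ : sup S + d / 2 < _); first by rewrite ge_min lexx orbT.
  by rewrite ltrD2l; lra.
have : S u.
  split; first by rewrite (le_trans aT (ltW uT)) ge_min lexx.
  right; case: ST => [<-//|WaT].
  move: aT; rewrite le_eqVlt => /predU1P[->//|aT].
  exact: avg_cat WTu.
by move=> /(ub_le_sup Sub); rewrite leNgt uT.
Qed.

End MeanValue.

Section StrictDerivative.
Variables (R : realType).
Implicit Types E F : tvsType R.

Lemma cvg_dnbhs (T : Type) (X : topologicalType) (D : set_system T) (g : T -> X)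
    (x : X) {FD : Filter D} : g @ D --> x -> (\forall t \near D, g t != x) ->
  g @ D --> x^'.
Proof.
move=> gx gn A xA; have := gx _ xA; near_simpl => h.
by apply: filter_app gn; apply: filter_app h; near=> t => + tx; apply.
Unshelve. all: by end_near. Qed.

(** The factor [k^-1] cancels the speed of the parametrization, so that the slope of this curve over
    [0, 1] is exactly a difference quotient of [f] with step [k]. *)
Lemma line_deriv E F (f : E -> F) x v (k s : R) l : k != 0 ->
  is_dirder f (x + (s * k) *: v) v l ->
  deriv_at (fun t : R => k^-1 *: f (x + (t * k) *: v)) s l.
Proof.
move=> k0 dfl; rewrite /deriv_at.
rewrite (_ : (fun _ => _) = (fun h : R => h^-1 *: (f (x + (s * k) *: v + h *: v)
    - f (x + (s * k) *: v))) \o (fun h => h * k)); last first.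
  apply/funext => h /=; rewrite -scalerBr scalerA -invfM mulrDl scalerDl addrA.
  by rewrite mulrC.
suff hk : (fun h : R => h * k) @ (0 : R)^' --> (0 : R)^' by exact: cvg_comp hk dfl.
apply: (@cvg_dnbhs _ _ (0 : R)^' (fun h : R => h * k)).
  rewrite -[X in _ --> X](mul0r k); apply: cvgMr_tmp.
  exact: cvg_within.
near=> h; rewrite mulf_neq0//; near: h; exact: nbhs_dnbhs_neq.
Unshelve. all: by end_near. Qed.

(** The mean value theorem in a convex neighbourhood gives strict
    differentiability of a [C^1] map. *)
Lemma cvg_strict_quotient (T : Type) (D : set_system T) E F (f : E -> F)
    (df : E -> E -> F) (U : set E) (x q : E) (z r : T -> E) (h : T -> R) {FD : Filter D} :
  open U -> U x ->
  (forall y v, U y -> is_dirder f y v (df y v)) ->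
  {for (x, q), continuous (fun p : E * E => df p.1 p.2)} ->
  z @ D --> x -> h @ D --> (0 : R) -> (\forall t \near D, h t != 0) ->
  r @ D --> q ->
  (fun t => (h t)^-1 *: (f (z t + h t *: r t) - f (z t))) @ D --> df x q.
Proof.
move=> oU Ux dfU dfc zx h0 hn rq V /convex_nbhs[W [oW Wl WV cW]].
have [[Y Q] [/= xY qQ] YQ] := dfc _ (open_nbhs_nbhs (conj oW Wl)).
have xYU : nbhs x (Y `&` U) by apply: filterI => //; exact: open_nbhs_nbhs.
have sc : (fun p : R * E => p.1 *: p.2) @ ((0 : R), q) --> (0 : E).
  by have := @scale_continuous R E (0 : R^o, q); rewrite /continuous_at /= scale0r.
have ac : (fun p : E * E => p.1 + p.2) @ (x, 0 : E) --> x.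
  by have := @add_continuous E (x, 0); rewrite /continuous_at /= addr0.
have [[Z O] [/= xZ O0] ZO] := ac _ xYU.
have [[K Q'] [/= K0 qQ'] KQ'] := sc _ O0.
have /nbhs_ballP[d /= d0 dK] := K0.
have zZ : \forall t \near D, Z (z t) by exact: zx.
have rQ : \forall t \near D, (Q `&` Q') (r t) by apply: rq; exact: filterI.
have hd : \forall t \near D, ball (0 : R) d (h t) by apply: h0; exact: nbhsx_ballx.
suff : \forall t \near D, W ((h t)^-1 *: (f (z t + h t *: r t) - f (z t))).
  by apply: filterS => t /WV.
near=> t.
have ht : h t != 0 by near: t.
have [Qt Q't] : (Q `&` Q') (r t) by near: t.
have Zt : Z (z t) by near: t.
have dt : ball (0 : R) d (h t) by near: t.
(* The slope over [0, 1] is the quotient itself; the derivative at [s] is [df] at a point of the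
   segment from [z t] to [z t + h t *: r t], all of which lies in [Y] and [U] because [K] is met in
   a ball around 0. *)
have := @mean_value R F (fun s => (h t)^-1 *: f (z t + (s * h t) *: r t)) W 0 1 oW
  cW ltr01.
rewrite subr0 invr1 scale1r mul1r mul0r scale0r addr0 scalerBr; apply.
move=> s /andP[s0 s1].
have [YU UU] : (Y `&` U) (z t + (s * h t) *: r t).
  apply: (ZO (_, _)); split => //=; apply: (KQ' (_, _)); split => //=.
  apply: dK; move: dt; rewrite /ball /= !sub0r !normrN normrM.
  by apply: le_lt_trans; rewrite (ger0_norm s0) ler_piMl.
exists (df (z t + (s * h t) *: r t) (r t)); first exact: (YQ (_, _)).
by apply: line_deriv => //; exact: dfU.
Unshelve. all: by end_near. Qed.

End StrictDerivative.

(** * Chain rule and stability properties of the classes C^n *)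

Section Calculus.
Variables (R : realType).
Implicit Types E F H : tvsType R.

Section TvsLimits.
Context {T : Type} {D : set_system T} {FD : Filter D}.

Lemma tvs_cvgD E (f g : T -> E) (a b : E) : f @ D --> a -> g @ D --> b ->
  (fun t => f t + g t) @ D --> a + b.
Proof. move=> fa gb; apply: (@cvg_comp _ _ _ (fun t => (f t, g t))
  (fun p : E * E => p.1 + p.2) _ _ _ _ (@add_continuous E (a, b))).
by have := cvg_pair fa gb; exact. Qed.

Lemma tvs_cvgB E (f g : T -> E) (a b : E) : f @ D --> a -> g @ D --> b ->
  (fun t => f t - g t) @ D --> a - b.
Proof. move=> fa gb; apply: (@cvg_comp _ _ _ (fun t => (f t, g t))
  (fun p : E * E => p.1 - p.2) _ _ _ _ (@sub_continuous E (a, b))).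
by have := cvg_pair fa gb; exact. Qed.

Lemma tvs_cvgZ E (f : T -> R) (g : T -> E) (a : R) (b : E) : f @ D --> a -> g @ D --> b ->
  (fun t => f t *: g t) @ D --> a *: b.
Proof.
move=> fa gb; apply: (@cvg_comp _ _ _ (fun t => (f t, g t))
  (fun p : R^o * E => p.1 *: p.2) _ _ _ _ (@scale_continuous R E (a : R^o, b))).
by have := cvg_pair fa gb; exact.
Qed.

End TvsLimits.

Lemma cvg_line E (x v : E) : (fun h : R => x + h *: v) @ (0 : R)^' --> x.
Proof.
rewrite -[X in _ --> X]addr0 -[X in _ + X](scale0r v).
apply: tvs_cvgD; first exact: cvg_cst.
by apply: tvs_cvgZ; [exact: cvg_within|exact: cvg_cst].
Qed.

Lemma is_dirder_near E F (f g : E -> F) (x v : E) l :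
  (\forall y \near x, f y = g y) -> is_dirder f x v l -> is_dirder g x v l.
Proof.
move=> fg; have fgx := nbhs_singleton fg; apply: cvg_trans; apply: near_eq_cvg.
have := @cvg_line E x v _ fg; near_simpl => h.
by apply: filterS h => h /= ->; rewrite fgx.
Qed.

(** Strict differentiability of [g] at the fixed base point [f x], with the difference quotients of
    [f] as moving directions: [f (x + h *: v)] is [f x] plus [h] times its own quotient. Of [f] only
    one directional derivative is needed. *)
Lemma is_dirder_comp E F H (f : E -> F) (g : F -> H) dg (V : set F) (x v : E) l :
  is_dirder f x v l -> open V -> V (f x) ->
  (forall y u, V y -> is_dirder g y u (dg y u)) ->
  {for (f x, l), continuous (fun p : F * F => dg p.1 p.2)} ->
  is_dirder (g \o f) x v (dg (f x) l).
Proof.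
move=> dfx oV Vfx dgV dgc.
have fxc : (fun _ : R => f x) @ (0 : R)^' --> f x by exact: cvg_cst.
have hcvg : (fun h : R => h) @ (0 : R)^' --> (0 : R) by exact: cvg_within.
have dq := @cvg_strict_quotient R R (0 : R)^' F H g dg V (f x) l (fun=> f x)
  (fun h => h^-1 *: (f (x + h *: v) - f x)) id (dnbhs_filter _) oV Vfx dgV dgc
  fxc hcvg (nbhs_dnbhs_neq _) dfx.
refine (cvg_trans _ dq); apply: near_eq_cvg; near=> h.
have h0 : h != 0 by near: h; exact: nbhs_dnbhs_neq.
by rewrite /= scalerA mulfV// scale1r [f x + _]addrC subrK.
Unshelve. all: by end_near. Qed.

Lemma is_dirder_pair E F H (f : E -> F) (g : E -> H) (x v : E) l k :
  is_dirder f x v l -> is_dirder g x v k ->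
  is_dirder (fun y => (f y, g y)) x v (l, k).
Proof. by move=> dfl dgk; exact: cvg_pair dfl dgk. Qed.

Lemma is_dirder_linear E F (f : E -> F) (x v : E) : linear f ->
  is_dirder f x v (f v).
Proof.
move=> lf; apply: cvg_near_cst; near=> h.
have h0 : h != 0 by near: h; exact: nbhs_dnbhs_neq.
by apply/eqP; rewrite [x + _]addrC lf addrK scalerA mulVf// scale1r.
Unshelve. all: by end_near. Qed.

Lemma Cn_on_continuous n E F (U : set E) (f : E -> F) x :
  Cn_on n U f -> U x -> {for x, continuous f}.
Proof. by case: n => [|n] [fc _]; exact: fc. Qed.

Lemma Cn_on_sub n E F (U V : set E) (f : E -> F) :
  V `<=` U -> Cn_on n U f -> Cn_on n V f.
Proof.
elim: n E F U V f => [|n IHn] E F U V f VU [fc dfc].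
  by split=> // x /VU/fc.
split; first by move=> x /VU/fc.
have [df [dfU Cdf]] := dfc; exists df; split; first by move=> x v /VU; exact: dfU.
by apply: IHn Cdf => p /= /VU.
Qed.

Lemma open_fst E F (U : set E) : open U -> open [set p : E * F | U p.1].
Proof. by move=> oU; apply: open_comp => // p _; exact: cvg_fst. Qed.

Lemma eq_Cn_on n E F (U : set E) (f g : E -> F) : open U ->
  (forall x, U x -> f x = g x) -> Cn_on n U f -> Cn_on n U g.
Proof.
elim: n E F U f g => [|n IHn] E F U f g oU fg [fc dfc];
  have fgn x : U x -> \forall y \near x, f y = g y.
  1, 3: by move=> Ux; apply: filterS fg _; exact: open_nbhs_nbhs.
all: have gc x : U x -> {for x, continuous g}.
  1, 3: move=> Ux; suff : g @ x --> g x by [];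
    rewrite -(fg x Ux); refine (cvg_trans _ (fc x Ux));
    by apply: near_eq_cvg; exact: fgn.
  by split.
split=> //; have [df [dfU Cdf]] := dfc; exists df; split => // x v Ux.
by apply: is_dirder_near (dfU x v Ux); exact: fgn.
Qed.

Lemma Cn_on_le n E F (U : set E) (f : E -> F) : Cn_on n.+1 U f -> Cn_on n U f.
Proof.
elim: n E F U f => [|n IHn] E F U f [fc [df [dfU Cdf]]]; split=> //.
by exists df; split=> //; exact: IHn.
Qed.

Lemma Cn_on_pair n E F H (U : set E) (f : E -> F) (g : E -> H) :
  Cn_on n U f -> Cn_on n U g -> Cn_on n U (fun x => (f x, g x)).
Proof.
elim: n E F H U f g => [|n IHn] E F H U f g [fc dfc] [gc dgc].
  by split=> // x Ux; apply: cvg_pair; [exact: fc|exact: gc].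
split; first by move=> x Ux; apply: cvg_pair; [exact: fc|exact: gc].
have [df [dfU Cdf]] := dfc; have [dg [dgU Cdg]] := dgc.
exists (fun x v => (df x v, dg x v)); split; last exact: IHn.
by move=> x v Ux; apply: is_dirder_pair; [exact: dfU|exact: dgU].
Qed.

(** The derivative of the composite is [dg] after the tangent map sending (x, v) to (f x, df x v),
    again a composite of maps one order less smooth, so the induction closes. *)
Lemma Cn_on_comp n E F H (U : set E) (V : set F) (f : E -> F) (g : F -> H) :
  open U -> open V -> (forall x, U x -> V (f x)) ->
  Cn_on n U f -> Cn_on n V g -> Cn_on n U (g \o f).
Proof.
elim: n E F H U V f g => [|n IHn] E F H U V f g oU oV UV Cf Cg.
  split=> // x Ux; apply: continuous_comp; first exact: Cn_on_continuous Cf Ux.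
  by apply: Cn_on_continuous Cg _; exact: UV.
split.
  move=> x Ux; apply: continuous_comp; first exact: Cn_on_continuous Cf Ux.
  by apply: Cn_on_continuous Cg _; exact: UV.
have [_ [df [dfU Cdf]]] := Cf; have [_ [dg [dgV Cdg]]] := Cg.
exists (fun x v => dg (f x) (df x v)); split.
  move=> x v Ux; apply: (is_dirder_comp (dfU _ _ Ux) oV (UV _ Ux) dgV).
  by apply: Cn_on_continuous Cdg _ => /=; exact: UV.
have Cff : Cn_on n [set p : E * E | U p.1] (f \o fst).
  apply: (IHn _ _ _ _ U) => //; first exact: open_fst.
    by apply: linear_smooth_on => // p; exact: cvg_fst.
  exact: Cn_on_le.
apply: (IHn _ _ _ _ [set p : F * F | V p.1] (fun p => (f p.1, df p.1 p.2))
  (fun p => dg p.1 p.2)) => //; [exact: open_fst|exact: open_fst| |].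
  by move=> p /= /UV.
exact: Cn_on_pair.
Qed.

End Calculus.

(** * Germs of smooth maps; linearity and symmetry of their derivatives *)

Section SmoothAt.
Variables (R : realType).
Implicit Types E F H : tvsType R.

(** Smoothness of a germ: composites and changes of chart then need no explicit domains. *)
Definition smooth_at E F (f : E -> F) (x : E) : Prop :=
  exists2 U, open_nbhs x U & smooth_on U f.

Lemma open_preimage_in (T U : topologicalType) (A : set T) (B : set U)
    (f : T -> U) : open A -> open B -> (forall x, A x -> {for x, continuous f}) ->
  open (A `&` f @^-1` B).
Proof.
rewrite !openE => oA oB fc x [Ax Bfx]; apply: filterI; first exact: oA.
by apply: fc => //; exact: oB.
Qed.

Lemma smooth_on_at E F (f : E -> F) (x : E) U :
  open U -> U x -> smooth_on U f -> smooth_at f x.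
Proof. by move=> oU Ux sf; exists U. Qed.

Lemma smooth_at_continuous E F (f : E -> F) (x : E) :
  smooth_at f x -> {for x, continuous f}.
Proof. by move=> [U [oU Ux] sf]; exact: Cn_on_continuous (sf 0%N) Ux. Qed.

Lemma smooth_at_near E F (f g : E -> F) (x : E) :
  (\forall y \near x, f y = g y) -> smooth_at f x -> smooth_at g x.
Proof.
rewrite /prop_near1 {1}nbhsE => -[V [oV Vx] Vfg] [U [oU Ux] sf].
exists (U `&` V); first by split; [exact: openI|split].
move=> n; apply: (@eq_Cn_on _ n _ _ _ f); first exact: openI.
  by move=> y [_ /Vfg].
by apply: Cn_on_sub (sf n) => y [].
Qed.

Lemma smooth_at_comp E F H (f : E -> F) (g : F -> H) (x : E) :
  smooth_at f x -> smooth_at g (f x) -> smooth_at (g \o f) x.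
Proof.
move=> [U [oU Ux] sf] [V [oV Vfx] sg].
have oUV : open (U `&` f @^-1` V).
  by apply: open_preimage_in => // y; exact: Cn_on_continuous (sf 0%N).
exists (U `&` f @^-1` V) => // n.
apply: (@Cn_on_comp _ n _ _ _ _ V) => //; first by move=> y [].
by apply: Cn_on_sub (sf n) => y [].
Qed.

Lemma smooth_at_pair E F H (f : E -> F) (g : E -> H) (x : E) :
  smooth_at f x -> smooth_at g x -> smooth_at (fun y => (f y, g y)) x.
Proof.
move=> [U [oU Ux] sf] [V [oV Vx] sg].
exists (U `&` V); first by split; [exact: openI|split].
move=> n; apply: Cn_on_pair; first by apply: Cn_on_sub (sf n) => y [].
by apply: Cn_on_sub (sg n) => y [].
Qed.

Lemma smooth_at_linear E F (f : E -> F) (x : E) :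
  linear f -> continuous f -> smooth_at f x.
Proof.
move=> lf fc; exists setT; first by split=> //; exact: openT.
exact: linear_smooth_on.
Qed.

Lemma smooth_at_id E (x : E) : smooth_at id x.
Proof. by apply: smooth_at_linear => // y; exact: cvg_id. Qed.

Lemma smooth_at_fst E F (x : E * F) : smooth_at fst x.
Proof. by apply: smooth_at_linear => // y; exact: cvg_fst. Qed.

Lemma smooth_at_snd E F (x : E * F) : smooth_at snd x.
Proof. by apply: smooth_at_linear => // y; exact: cvg_snd. Qed.

Lemma smooth_at_cst E F (x : E) (k : F) : smooth_at (fun _ => k) x.
Proof.
exists setT; first by split=> //; exact: openT.
have C0 n E' F' : Cn_on n [set: E'] (fun _ => 0 : F').
  by apply: linear_smooth_on => [a u v|y]; [rewrite scaler0 addr0|exact: cvg_cst].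
case=> [|n]; split=> //; try by move=> y _; exact: cvg_cst.
exists (fun _ _ => 0); split; last by apply: Cn_on_sub (C0 _ _ _).
by move=> y v _; rewrite /is_dirder subrr; under eq_fun do rewrite scaler0;
  exact: cvg_cst.
Qed.

Lemma add_linear E : linear (fun p : E * E => p.1 + p.2).
Proof. by move=> a u v /=; rewrite scalerDr addrACA. Qed.

Lemma smooth_atD E F (f g : E -> F) (x : E) :
  smooth_at f x -> smooth_at g x -> smooth_at (fun y => f y + g y) x.
Proof.
move=> sf sg.
apply: (@smooth_at_comp _ (F * F)%type _ (fun y => (f y, g y))
  (fun p => p.1 + p.2)); first exact: smooth_at_pair.
by apply: smooth_at_linear; [exact: add_linear|exact: add_continuous].
Qed.

Lemma smooth_at_scale E (v : E) (s : R^o) : smooth_at (fun t : R^o => t *: v) s.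
Proof.
apply: smooth_at_linear => [a t u|t]; first by rewrite scalerDl scalerA.
by apply: tvs_cvgZ; [exact: cvg_id|exact: cvg_cst].
Qed.

Lemma smooth_at_is_dirder E F (f : E -> F) (x v : E) :
  smooth_at f x -> is_dirder f x v (dirder f x v).
Proof.
move=> [U [oU Ux] /(_ 1%N)[_ [df [/(_ _ v Ux) dfU _]]]].
by rewrite /dirder; case: xgetP => [y -> //|/(_ (df x v))].
Qed.

Arguments smooth_at_is_dirder {E F f x} v.

Lemma dirderE E F (f : E -> F) (x v : E) l : hausdorff_space F ->
  is_dirder f x v l -> dirder f x v = l.
Proof.
move=> hF dl; rewrite /dirder; case: xgetP => [y -> dy|/(_ l)//].
exact: (cvg_unique hF dy dl).
Qed.

Lemma dirder_near E F (f g : E -> F) (x v : E) :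
  (\forall y \near x, f y = g y) -> dirder f x v = dirder g x v.
Proof.
move=> fg; rewrite /dirder; congr xget; apply/seteqP; split => l /=.
  exact: is_dirder_near.
by apply: is_dirder_near; apply: filterS fg => y.
Qed.

(** [Cn_on] provides a possibly different derivative for each order; uniqueness of limits identifies
    all of them with [dirder f] near [x]. *)
Lemma smooth_at_dirder E F (f : E -> F) (x v : E) : hausdorff_space F ->
  smooth_at f x -> smooth_at (fun p : E * E => dirder f p.1 p.2) (x, v).
Proof.
move=> hF [U [oU Ux] sf]; exists [set p : E * E | U p.1].
  by split=> //; exact: open_fst.
move=> n; have [_ [df [dfU Cdf]]] := sf n.+1.
apply: eq_Cn_on Cdf; first exact: open_fst.
by move=> p /= Up; rewrite (dirderE hF (dfU _ _ Up)).
Qed.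

Arguments smooth_at_dirder {E F f x} v.

Lemma dirder_comp E F H (f : E -> F) (g : F -> H) (x v : E) :
  hausdorff_space H -> smooth_at f x -> smooth_at g (f x) ->
  dirder (g \o f) x v = dirder g (f x) (dirder f x v).
Proof.
move=> hH sf sg; apply: dirderE => //; have [V [oV Vfx] sV] := sg.
apply: (is_dirder_comp _ oV Vfx); first exact: smooth_at_is_dirder.
  by move=> y u Vy; apply: smooth_at_is_dirder; exists V.
apply: (@smooth_at_continuous _ _ (fun p : F * F => dirder g p.1 p.2)).
exact: smooth_at_dirder.
Qed.

Lemma hausdorff_prod (T U : topologicalType) :
  hausdorff_space T -> hausdorff_space U -> hausdorff_space (T * U)%type.
Proof.
move=> hT hU [a b] [c d] ab_cd; congr (_, _).
  apply: hT => A B aA cB; have [||[x y] [[/= Ax _] [/= Bx _]]] :=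
    ab_cd (A `*` setT) (B `*` setT); last by exists x.
  - by exists (A, setT) => //; split=> //; exact: filterT.
  - by exists (B, setT) => //; split=> //; exact: filterT.
apply: hU => A B bA dB; have [||[x y] [[/= _ Ay] [/= _ By]]] :=
  ab_cd (setT `*` A) (setT `*` B); last by exists y.
- by exists (setT, A) => //; split=> //; exact: filterT.
- by exists (setT, B) => //; split=> //; exact: filterT.
Qed.

Lemma dirder_pair E F H (f : E -> F) (g : E -> H) (x v : E) :
  hausdorff_space F -> hausdorff_space H -> smooth_at f x -> smooth_at g x ->
  dirder (fun y => (f y, g y)) x v = (dirder f x v, dirder g x v).
Proof.
move=> hF hH sf sg; apply: dirderE; first exact: hausdorff_prod.
by apply: is_dirder_pair; exact: smooth_at_is_dirder.
Qed.

Lemma dirder_of_linear E F (f : E -> F) (x v : E) : hausdorff_space F ->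
  linear f -> dirder f x v = f v.
Proof. by move=> hF lf; apply: dirderE => //; exact: is_dirder_linear. Qed.

Lemma dirder_scale E F (f : E -> F) (x v : E) (a : R) : hausdorff_space F ->
  smooth_at f x -> dirder f x (a *: v) = a *: dirder f x v.
Proof.
move=> hF sf; apply: dirderE => //.
have [->|a0] := eqVneq a 0.
  rewrite !scale0r /is_dirder; under eq_fun do rewrite scaler0 addr0 subrr scaler0.
  exact: cvg_cst.
have dv := smooth_at_is_dirder v sf; rewrite /is_dirder.
have ha : (fun h : R => h * a) @ (0 : R)^' --> (0 : R)^'.
  apply: (@cvg_dnbhs _ _ (0 : R)^' (fun h : R => h * a)).
    by rewrite -[X in _ --> X](mul0r a); apply: cvgMr_tmp; exact: cvg_within.
  by near=> h; rewrite mulf_neq0//; near: h; exact: nbhs_dnbhs_neq.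
have ca : (fun _ : R => a) @ (0 : R)^' --> a by exact: cvg_cst.
have dva : (fun h : R => (h * a)^-1 *: (f (x + (h * a) *: v) - f x)) @ (0 : R)^'
  --> dirder f x v by exact: (cvg_comp _ _ ha dv).
have dE : (fun h : R => h^-1 *: (f (x + h *: (a *: v)) - f x)) =
    (fun h => a *: ((h * a)^-1 *: (f (x + (h * a) *: v) - f x))).
  apply/funext => h /=; rewrite !scalerA invfM.
  by rewrite [h^-1 * _]mulrC mulrA mulfV// mul1r.
by rewrite dE; exact: tvs_cvgZ.
Unshelve. all: by end_near. Qed.

(** The increment along [u + v] is split at [x + h *: v]. The piece along [u] then has a moving base
    point, which is what strict differentiability allows. *)
Lemma dirderD E F (f : E -> F) (x u v : E) : hausdorff_space F ->
  smooth_at f x -> dirder f x (u + v) = dirder f x u + dirder f x v.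
Proof.
move=> hF sf; have [U [oU Ux] sU] := sf; apply: dirderE => //.
have xuc : (fun h : R => x + h *: v) @ (0 : R)^' --> x by exact: cvg_line.
have uc : (fun _ : R => u) @ (0 : R)^' --> u by exact: cvg_cst.
have hc : (fun h : R => h) @ (0 : R)^' --> (0 : R) by exact: cvg_within.
have dU y w : U y -> is_dirder f y w (dirder f y w).
  by move=> Uy; apply: smooth_at_is_dirder; exists U.
have dq := @cvg_strict_quotient R R (0 : R)^' E F f _ U x u
  (fun h => x + h *: v) (fun=> u) id (dnbhs_filter _) oU Ux dU
  (smooth_at_continuous (smooth_at_dirder u hF sf)) xuc hc (nbhs_dnbhs_neq _) uc.
have dE : (fun h : R => h^-1 *: (f (x + h *: (u + v)) - f x)) =
    (fun h => h^-1 *: (f (x + h *: v + h *: u) - f (x + h *: v)) +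
      h^-1 *: (f (x + h *: v) - f x)).
  apply/funext => h; rewrite -scalerDr addrA subrK; congr (_ *: (f _ - _)).
  by rewrite scalerDr addrA addrAC.
by rewrite /is_dirder dE; apply: tvs_cvgD => //; exact: smooth_at_is_dirder.
Qed.

Lemma dirder_linear E F (f : E -> F) (x : E) : hausdorff_space F ->
  smooth_at f x -> linear (dirder f x).
Proof. by move=> hF sf a u v; rewrite dirderD// dirder_scale. Qed.

Lemma is_dirder_cst E F (k : F) (x v : E) : is_dirder (fun=> k) x v 0.
Proof.
rewrite /is_dirder subrr; under eq_fun do rewrite scaler0; exact: cvg_cst.
Qed.

Lemma is_dirderD E F (f g : E -> F) (x v : E) l l' :
  is_dirder f x v l -> is_dirder g x v l' ->
  is_dirder (fun y => f y + g y) x v (l + l').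
Proof.
move=> dfl dgl; rewrite /is_dirder.
have -> : (fun h : R => h^-1 *: (f (x + h *: v) + g (x + h *: v) - (f x + g x))) =
    (fun h => h^-1 *: (f (x + h *: v) - f x) + h^-1 *: (g (x + h *: v) - g x)).
  by apply/funext => h; rewrite -scalerDr opprD addrACA.
exact: tvs_cvgD.
Qed.

(** The two difference quotients are the same function, so the equality holds even where no
    derivative exists and [xget] returns its default. *)
Lemma dirder_fst E F H (f : E * F -> H) x y u :
  dirder f (x, y) (u, 0) = dirder (fun z => f (z, y)) x u.
Proof.
rewrite /dirder; congr xget; apply/funext => l; rewrite /is_dirder.
suff -> : (fun h : R => h^-1 *: (f ((x, y) + h *: (u, 0)) - f (x, y))) =
  (fun h => h^-1 *: (f (x + h *: u, y) - f (x, y))) by [].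
by apply/funext => h; congr (_ *: (f _ - _)); congr pair; rewrite /= scaler0 addr0.
Qed.

Lemma dirder_snd E F H (f : E * F -> H) x y v :
  dirder f (x, y) (0, v) = dirder (fun z => f (x, z)) y v.
Proof.
rewrite /dirder; congr xget; apply/funext => l; rewrite /is_dirder.
suff -> : (fun h : R => h^-1 *: (f ((x, y) + h *: (0, v)) - f (x, y))) =
  (fun h => h^-1 *: (f (x, y + h *: v) - f (x, y))) by [].
by apply/funext => h; congr (_ *: (f _ - _)); congr pair; rewrite /= scaler0 addr0.
Qed.

(** The mean value theorem on [s |-> f (x + s u + h v) - f (x + s u)]. *)
Lemma cvg_second_difference E F (f : E -> F) (x u v : E) : hausdorff_space F ->
  smooth_at f x ->
  (fun h : R => h^-1 *: (h^-1 *: ((f (x + h *: u + h *: v) - f (x + h *: u))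
     - (f (x + h *: v) - f x)))) @ (0 : R)^' -->
  dirder (fun y => dirder f y u) x v.
Proof.
move=> hF sf; have [U [oU Ux] sU] := sf.
pose G (p : E * E) := dirder f p.1 p.2.
have sfU y : U y -> smooth_at f y by move=> Uy; exists U.
have sG y w : U y -> smooth_at G (y, w) by move=> /sfU; exact: smooth_at_dirder.
rewrite (_ : dirder _ x v = dirder G (x, u) (v, 0)); last by rewrite dirder_fst.
move=> V /convex_nbhs[W [oW Wl WV cW]].
(* The position along [u] and the step along [v] vary independently; later they are [s * h] and [h],
   and the bound must hold for all [s] in [0, 1] at once. *)
pose D := filter_prod (nbhs (0 : R)) (0 : R)^'.
have FD : Filter D by exact: filter_prod_filter.
have s0 : (fun p : R * R => p.1) @ D --> (0 : R) by exact: cvg_fst.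
have h0 : (fun p : R * R => p.2) @ D --> (0 : R).
  by apply: (@cvg_trans _ (0 : R)^'); [exact: cvg_snd|exact: cvg_within].
have n0 : \forall h \near (0 : R)^', h != 0 by exact: nbhs_dnbhs_neq.
have hn : \forall p \near D, p.2 != 0.
  exists (setT, [set h : R | h != 0]); last by move=> p [].
  by split; [exact: filterT|exact: n0].
have zc : (fun p : R * R => x + p.1 *: u) @ D --> x.
  rewrite -[X in _ --> X]addr0 -[X in _ + X](scale0r u).
  by apply: tvs_cvgD; [exact: cvg_cst|apply: tvs_cvgZ => //; exact: cvg_cst].
have zc' : (fun p : R * R => x + p.1 *: u + p.2 *: v) @ D --> x.
  rewrite -[X in _ --> X]addr0 -[X in _ + X](scale0r v).
  by apply: tvs_cvgD => //; apply: tvs_cvgZ => //; exact: cvg_cst.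
have zcu : (fun p : R * R => (x + p.1 *: u, u)) @ D --> (x, u).
  have uc : (fun _ : R * R => u) @ D --> u by exact: cvg_cst.
  by have := cvg_pair zc uc; exact.
have vc : (fun _ : R * R => (v, 0 : E)) @ D --> (v, 0 : E) by exact: cvg_cst.
have oU' : open [set p : E * E | U p.1] by exact: open_fst.
have dG p q : U p.1 -> is_dirder G p q (dirder G p q).
  by case: p => y w Uy; apply: smooth_at_is_dirder; exact: sG.
have Gc := smooth_at_continuous (smooth_at_dirder (v, 0) hF (sG x u Ux)).
have dq := @cvg_strict_quotient R (R * R)%type D (E * E)%type F G _ _ (x, u) (v, 0)
  (fun p => (x + p.1 *: u, u)) (fun=> (v, 0)) snd FD oU' Ux dG Gc zcu h0 hn vc.
have WD : \forall p \near D, W (p.2^-1 *: (dirder f (x + p.1 *: u + p.2 *: v) u -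
    dirder f (x + p.1 *: u) u)).
  have dW : D (fun p => W (p.2^-1 *: (G ((x + p.1 *: u, u) + p.2 *: (v, 0)) -
      G (x + p.1 *: u, u)))) := dq _ (open_nbhs_nbhs (conj oW Wl)).
  by apply: (filterS _ dW) => p; rewrite /G /= scaler0 addr0.
have UD : \forall p \near D, U (x + p.1 *: u + p.2 *: v) /\ U (x + p.1 *: u).
  have Un : nbhs x U by exact: open_nbhs_nbhs.
  have U1 : D [set p | U (x + p.1 *: u + p.2 *: v)] := zc' _ Un.
  have U2 : D [set p | U (x + p.1 *: u)] := zc _ Un.
  exact: filterI U1 U2.
have [[A B] [/= A0 B0] AB] := filterI WD UD.
have /nbhs_ballP[d /= d0 dA] := A0.
suff : \forall h \near (0 : R)^', W (h^-1 *: (h^-1 *: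
  ((f (x + h *: u + h *: v) - f (x + h *: u)) - (f (x + h *: v) - f x)))).
  by apply: filterS => h /WV.
near=> h.
have hn0 : h != 0 by near: h; exact: nbhs_dnbhs_neq.
have Bh : B h by near: h.
have hd : ball (0 : R) d h.
  by near: h; apply: (@cvg_within _ (nbhs (0 : R))); exact: nbhsx_ballx.
pose f1 y := h^-1 *: (f (y + h *: v) - f y).
have := @mean_value R F (fun s => h^-1 *: f1 (x + (s * h) *: u)) W 0 1 oW cW ltr01.
rewrite subr0 invr1 scale1r mul1r mul0r scale0r addr0 -scalerBr /f1 -scalerBr; apply.
move=> s /andP[s0' s1].
have /= [] := AB (s * h, h).
  split=> //=; apply: dA; move: hd; rewrite /ball /= !sub0r !normrN normrM.
  by apply: le_lt_trans; rewrite (ger0_norm s0') ler_piMl.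
move=> Ws [U1 U2].
exists (h^-1 *: (dirder f (x + (s * h) *: u + h *: v) u -
    dirder f (x + (s * h) *: u) u)) => //.
apply: (@line_deriv _ _ _ f1) => //.
have dE : (fun k : R => k^-1 *: (f1 (x + (s * h) *: u + k *: u) - f1 (x + (s * h) *: u)))
  = (fun k => h^-1 *: (k^-1 *: (f (x + (s * h) *: u + h *: v + k *: u) -
       f (x + (s * h) *: u + h *: v)) -
     k^-1 *: (f (x + (s * h) *: u + k *: u) - f (x + (s * h) *: u)))).
  apply/funext => k; rewrite /f1 -!scalerBr !scalerA [h^-1 * _]mulrC.
  congr (_ *: _); rewrite [x + _ + k *: u + _]addrAC.
  by rewrite !opprB addrACA [RHS]addrACA; congr (_ + _); rewrite addrC.
rewrite /is_dirder dE; apply: tvs_cvgZ; first exact: cvg_cst.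
apply: tvs_cvgB; [exact: smooth_at_is_dirder (sfU _ U1)|].
exact: smooth_at_is_dirder (sfU _ U2).
Unshelve. all: by end_near. Qed.

Arguments cvg_second_difference {E F f x} u v.

(** Both sides are limits of one second difference, which is symmetric in [u] and [v]. *)
Lemma schwarz E F (f : E -> F) (x u v : E) : hausdorff_space F ->
  smooth_at f x ->
  dirder (fun y => dirder f y u) x v = dirder (fun y => dirder f y v) x u.
Proof.
move=> hF sf; have duv := cvg_second_difference u v hF sf.
apply: (cvg_unique hF duv).
have := cvg_second_difference v u hF sf.
suff -> : (fun h : R => h^-1 *: (h^-1 *: ((f (x + h *: v + h *: u) - f (x + h *: v))
     - (f (x + h *: u) - f x)))) = (fun h : R => h^-1 *: (h^-1 *:
  ((f (x + h *: u + h *: v) - f (x + h *: u)) - (f (x + h *: v) - f x)))) by [].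
apply/funext => h; rewrite [x + _ + _]addrAC; congr (_ *: (_ *: _)).
by rewrite !opprB addrACA [RHS]addrACA; congr (_ + _); rewrite addrC.
Qed.

(** By the mean value theorem every slope of [c] lies in each convex neighbourhood of 0, hence is 0
    since [F] is Hausdorff. *)
Lemma dirder0_cst F (c : R -> F) (e : R) : hausdorff_space F ->
  (forall t : R, `|t| < e -> is_dirder (c : R^o -> F) t 1 0) ->
  forall t : R, `|t| < e -> c t = c 0.
Proof.
move=> hF dc.
have cst a b : - e < a -> a < b -> b < e -> c a = c b.
  move=> ea ab be; apply/esym/eqP; rewrite -subr_eq0.
  suff : 0 = (b - a)^-1 *: (c b - c a).
    by move=> /esym/eqP; rewrite scaler_eq0 invr_eq0 (subr_eq0 b) gt_eqF.
  apply: (hF 0) => A B A0 Bba; have [W [oW W0 WA cW]] := convex_nbhs A0.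
  exists ((b - a)^-1 *: (c b - c a)); split; last exact: nbhs_singleton.
  apply: WA; apply: (mean_value oW cW ab) => s /andP[a_s sb]; exists 0 => //.
  have := dc s; rewrite /is_dirder /deriv_at.
  have -> : (fun h : R => h^-1 *: (c (s + h *: (1 : R^o)) - c s)) =
    (fun h : R => h^-1 *: (c (s + h) - c s)).
    by apply/funext => h; rewrite /GRing.scale /= mulr1.
  by apply; rewrite ltr_norml; apply/andP; split; lra.
move=> t; rewrite ltr_norml => /andP[et te].
have [t0|t0|->//] := ltgtP t 0; first by apply: cst => //; lra.
by apply/esym/cst => //; lra.
Qed.

End SmoothAt.

Arguments smooth_at_is_dirder {R E F f x} v.
Arguments smooth_at_dirder {R E F f x} v.

(** * Manifolds and smooth maps *)

Section Charts.
Variables (R : realType) (M : topologicalType) (E : tvsType R) (c : chart M E).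

Lemma cinv_dom y : ccod c y -> cdom c (cinv c y).
Proof. by case=> x xc <-; rewrite cfunK. Qed.

Lemma cinvK y : ccod c y -> c (cinv c y) = y.
Proof. by case=> x xc <-; rewrite cfunK. Qed.

Lemma cfun_cod x : cdom c x -> ccod c (c x).
Proof. by move=> xc; exists x. Qed.

Lemma near_cdom x : cdom c x -> \forall y \near x, cdom c y.
Proof. by move=> xc; apply: open_nbhs_nbhs; split=> //; exact: cdom_open. Qed.

Lemma near_ccod y : ccod c y -> \forall z \near y, ccod c z.
Proof. by move=> yc; apply: open_nbhs_nbhs; split=> //; exact: ccod_open. Qed.

Lemma cvg_cinv x : cdom c x -> cinv c @ (c x) --> x.
Proof.
move=> xc; rewrite -[X in _ --> X](cfunK xc).
exact: cinv_continuous (cfun_cod xc).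
Qed.

End Charts.

Section SmoothMaps.
Variables (R : realType).
Implicit Types (M N P Q : manifold R) (E F : tvsType R).

Definition msmooth_at M N (f : M -> N) (x : M) : Prop :=
  {for x, continuous f} /\
  forall (c : chart M (mmodel M)) (d : chart N (mmodel N)),
    atlas c -> atlas d -> cdom c x -> cdom d (f x) ->
    smooth_at (d \o f \o cinv c) (c x).

Lemma smooth_at_transition M (c d : chart M (mmodel M)) x :
  atlas c -> atlas d -> cdom c x -> cdom d x -> smooth_at (d \o cinv c) (c x).
Proof.
move=> ca da xc xd; apply: smooth_on_at (atlas_compat ca da); last by exists x.
rewrite (_ : _ @` _ = ccod c `&` cinv c @^-1` cdom d).
  apply: open_preimage_in; [exact: ccod_open|exact: cdom_open|].
  by move=> y yc; exact: cinv_continuous.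
apply/seteqP; split=> [_ [y [yc yd] <-]|y [[z zc <-]]].
  by split; [exact: cfun_cod|rewrite /= cfunK].
by rewrite /= cfunK // => zd; exists z.
Qed.

(** One pair of charts suffices, since transition maps relate it to any other pair. *)
Lemma msmooth_at_charts M N (f : M -> N) x
    (c : chart M (mmodel M)) (d : chart N (mmodel N)) :
  {for x, continuous f} -> atlas c -> atlas d -> cdom c x -> cdom d (f x) ->
  smooth_at (d \o f \o cinv c) (c x) -> msmooth_at f x.
Proof.
move=> fc ca da xc xd sf; split=> // c' d' c'a d'a xc' xd'.
have st := smooth_at_transition c'a ca xc' xc.
have sn := smooth_at_transition da d'a xd xd'.
have s1 : smooth_at ((d \o f \o cinv c) \o (c \o cinv c')) (c' x).
  by apply: smooth_at_comp => //; rewrite /= cfunK.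
have s2 : smooth_at ((d' \o cinv d) \o ((d \o f \o cinv c) \o (c \o cinv c')))
    (c' x).
  by apply: smooth_at_comp s1 _; rewrite /= !cfunK.
apply: smooth_at_near s2.
have nc : \forall y \near c' x, cdom c (cinv c' y).
  exact: cvg_cinv xc' _ (near_cdom xc).
have nd : \forall y \near c' x, cdom d (f (cinv c' y)).
  exact: cvg_cinv xc' _ (fc _ (near_cdom xd)).
by apply: filterS2 nc nd => y yc yd; rewrite /= !cfunK.
Qed.

Lemma msmooth_at_continuous M N (f : M -> N) x :
  msmooth_at f x -> f @ x --> f x.
Proof. by case. Qed.

Lemma msmooth_on_at M N (f : M -> N) x U :
  open U -> U x -> msmooth_on U f -> msmooth_at f x.
Proof.
move=> oU Ux [fc sf]; split; first exact: fc.
move=> c d ca da xc xd; apply: smooth_on_at (sf c d ca da); last by exists x.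
rewrite (_ : _ @` _ = (ccod c `&` cinv c @^-1` U) `&`
    (f \o cinv c) @^-1` cdom d); last first.
  apply/seteqP; split=> [_ [y [[Uy yc] yd] <-]|y [[[z zc <-]]]].
    by split; [split; [exact: cfun_cod|rewrite /= cfunK]|rewrite /= cfunK].
  by rewrite /= cfunK // => Uz zd; exists z.
apply: open_preimage_in; last first.
- move=> y [yc Uy]; apply: continuous_comp; first exact: cinv_continuous.
  exact: fc.
- exact: cdom_open.
- apply: open_preimage_in => //; first exact: ccod_open.
  by move=> y yc; exact: cinv_continuous.
Qed.

Lemma msmooth_msmooth_at M N (f : M -> N) x : msmooth f -> msmooth_at f x.
Proof. by move=> sf; apply: msmooth_on_at sf; first exact: openT. Qed.

Lemma msmooth_at_near M N (f g : M -> N) x :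
  (\forall y \near x, f y = g y) -> msmooth_at f x -> msmooth_at g x.
Proof.
move=> fg [fc sf]; have fgx := nbhs_singleton fg; split.
  suff : g @ x --> g x by [].
  by rewrite -fgx; refine (cvg_trans _ fc); exact: near_eq_cvg.
move=> c d ca da xc xd; rewrite -fgx in xd.
apply: smooth_at_near (sf c d ca da xc xd).
have nc := cvg_cinv xc fg.
have nc' : \forall y \near c x, f (cinv c y) = g (cinv c y) := nc.
by apply: filterS nc' => y /= ->.
Qed.

Lemma msmooth_at_comp M N P (f : M -> N) (g : N -> P) x :
  msmooth_at f x -> msmooth_at g (f x) -> msmooth_at (g \o f) x.
Proof.
move=> [fc sf] [gc sg].
pose c := chart_at x; pose d := chart_at (f x); pose e := chart_at (g (f x)).
have [ca da ea] : [/\ atlas c, atlas d & atlas e].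
  by split; exact: chart_at_atlas.
have [xc xd xe] : [/\ cdom c x, cdom d (f x) & cdom e (g (f x))].
  by split; exact: chart_at_dom.
apply: (msmooth_at_charts _ ca ea) => //; first exact: continuous_comp.
have s1 := sf c d ca da xc xd; have s2 := sg d e da ea xd xe.
have s3 : smooth_at ((e \o g \o cinv d) \o (d \o f \o cinv c)) (c x).
  by apply: smooth_at_comp s1 _; rewrite /= cfunK.
apply: smooth_at_near s3.
have nd : \forall y \near c x, cdom d (f (cinv c y)).
  exact: cvg_cinv xc _ (fc _ (near_cdom xd)).
by apply: filterS nd => y yd; rewrite /= cfunK.
Qed.

Lemma msmooth_at_vect E F (f : E -> F) x :
  smooth_at f x -> @msmooth_at (vect_manifold E) (vect_manifold F) f x.
Proof.
move=> sf; split; first exact: smooth_at_continuous.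
by move=> c d -> -> _ _.
Qed.

Lemma msmooth_at_from_vect E M (f : E -> M) x (c : chart M (mmodel M)) :
  atlas c -> cdom c (f x) -> {for x, continuous f} -> smooth_at (c \o f) x ->
  @msmooth_at (vect_manifold E) M f x.
Proof.
move=> ca xc fc sf.
exact: (@msmooth_at_charts (vect_manifold E) M f x (id_chart E) c).
Qed.

Lemma msmooth_at_coord E M (f : E -> M) x (c : chart M (mmodel M)) :
  atlas c -> cdom c (f x) -> @msmooth_at (vect_manifold E) M f x ->
  smooth_at (c \o f) x.
Proof. by move=> ca xc [_ /(_ (id_chart E) c)]; apply. Qed.

Lemma msmooth_at_cfun M (c : chart M (mmodel M)) x : atlas c -> cdom c x ->
  @msmooth_at M (vect_manifold (mmodel M)) c x.
Proof.
move=> ca xc.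
apply: (@msmooth_at_charts M (vect_manifold _) c x c (id_chart _)) => //.
  exact: cfun_continuous.
apply: smooth_at_near (smooth_at_id (c x)).
by apply: filterS (near_ccod (cfun_cod xc)) => y yc; rewrite /= cinvK.
Qed.

Lemma msmooth_at_cinv M (c : chart M (mmodel M)) y : atlas c -> ccod c y ->
  @msmooth_at (vect_manifold (mmodel M)) M (cinv c) y.
Proof.
move=> ca yc.
apply: (@msmooth_at_from_vect _ M _ _ c) => //; first exact: cinv_dom.
  exact: cinv_continuous.
apply: smooth_at_near (smooth_at_id y).
by apply: filterS (near_ccod yc) => z zc; rewrite /= cinvK.
Qed.

(** The rule through which group multiplication and the action are used: both arguments depend on a
    common variable, so no product manifold has to be formed. *)
Lemma msmooth2_at M N P Q (f : M -> N -> P) (g : Q -> M) (h : Q -> N) q :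
  msmooth2 f -> msmooth_at g q -> msmooth_at h q ->
  msmooth_at (fun x => f (g x) (h x)) q.
Proof.
move=> [fc sf] [gc sg] [hc sh].
pose k := chart_at q; pose c := chart_at (g q); pose d := chart_at (h q).
pose e := chart_at (f (g q) (h q)).
have [ka ca da ea] : [/\ atlas k, atlas c, atlas d & atlas e].
  by split; exact: chart_at_atlas.
have [qk xc xd xe] : [/\ cdom k q, cdom c (g q), cdom d (h q) &
    cdom e (f (g q) (h q))] by split; exact: chart_at_dom.
have fghc : {for q, continuous (fun x => f (g x) (h x))}.
  have gh : (fun x => (g x, h x)) @ q --> (g q, h q) by have := cvg_pair gc hc; exact.
  exact: (cvg_comp _ _ gh (fc (g q, h q))).
apply: (msmooth_at_charts fghc ka ea) => //.
pose S := [set p : mmodel M * mmodel N | ccod c p.1 /\ ccod d p.2 /\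
  cdom e (f (cinv c p.1) (cinv d p.2))].
have oS : open S.
  rewrite (_ : S = ([set p | ccod c p.1] `&` [set p | ccod d p.2]) `&`
    (fun p => f (cinv c p.1) (cinv d p.2)) @^-1` cdom e); last first.
    by apply/seteqP; split=> p; [move=> [? []]|move=> [[? ?] ?]].
  apply: open_preimage_in; last first.
  - move=> p [/= p1 p2].
    have c1 : (fun p : mmodel M * mmodel N => cinv c p.1) @ p --> cinv c p.1.
      by apply: (cvg_comp _ _ (@cvg_fst _ _ _ _ _)); exact: cinv_continuous.
    have c2 : (fun p : mmodel M * mmodel N => cinv d p.2) @ p --> cinv d p.2.
      by apply: (cvg_comp _ _ (@cvg_snd _ _ _ _ _)); exact: cinv_continuous.
    have c12 : (fun p : mmodel M * mmodel N => (cinv c p.1, cinv d p.2)) @ p -->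
        (cinv c p.1, cinv d p.2) by have := cvg_pair c1 c2; exact.
    exact: (cvg_comp _ _ c12 (fc (cinv c p.1, cinv d p.2))).
  - exact: cdom_open.
  - apply: openI; last first.
      by apply: open_comp; [move=> p _; exact: cvg_snd|exact: ccod_open].
    by apply: open_comp; [move=> p _; exact: cvg_fst|exact: ccod_open].
have s1 := sg k c ka ca qk xc; have s2 := sh k d ka da qk xd.
have s3 := smooth_at_pair s1 s2.
have s4 : smooth_at (fun p => e (f (cinv c p.1) (cinv d p.2)))
    ((c \o g \o cinv k) (k q), (d \o h \o cinv k) (k q)).
  apply: smooth_on_at oS _ (sf c d e ca da ea) => /=.
  rewrite /S /= !cfunK//.
  by split; [exact: cfun_cod|split; [exact: cfun_cod|]].
apply: smooth_at_near (smooth_at_comp s3 s4).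
have nc : \forall y \near k q, cdom c (g (cinv k y)).
  exact: cvg_cinv qk _ (gc _ (near_cdom xc)).
have nd : \forall y \near k q, cdom d (h (cinv k y)).
  exact: cvg_cinv qk _ (hc _ (near_cdom xd)).
by apply: filterS2 nc nd => y yc yd; rewrite /= !cfunK.
Qed.

Lemma msmooth_at_cst M N (k : N) (x : M) : msmooth_at (fun _ : M => k) x.
Proof.
apply: (@msmooth_at_charts _ _ _ _ (chart_at x) (chart_at k));
  [exact: cvg_cst|exact: chart_at_atlas|exact: chart_at_atlas|
   exact: chart_at_dom|exact: chart_at_dom|exact: smooth_at_cst].
Qed.

Lemma mderiv_vect E F (f : E -> F) x v :
  mderiv (vect_manifold E) (vect_manifold F) f x v = dirder f x v.
Proof. by []. Qed.

Lemma mderiv_near M N (f g : M -> N) x (X : mmodel M) :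
  (\forall y \near x, f y = g y) ->
  mderiv M N f x X = mderiv M N g x X :> mmodel N.
Proof.
move=> fg; rewrite /mderiv -(nbhs_singleton fg); apply: dirder_near.
have nc : \forall y \near chart_at x x, f (cinv (chart_at x) y) = g (cinv (chart_at x) y).
  exact: cvg_cinv (chart_at_dom x) _ fg.
by apply: filterS nc => y /= ->.
Qed.

Lemma mderiv_comp M N P (f : M -> N) (g : N -> P) x (X : mmodel M) :
  hausdorff_space (mmodel P) -> msmooth_at f x -> msmooth_at g (f x) ->
  mderiv M P (g \o f) x X = mderiv N P g (f x) (mderiv M N f x X).
Proof.
move=> hP [fc sf] [gc sg].
pose c := chart_at x; pose d := chart_at (f x); pose e := chart_at (g (f x)).
have [ca da ea] : [/\ atlas c, atlas d & atlas e].
  by split; exact: chart_at_atlas.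
have [xc xd xe] : [/\ cdom c x, cdom d (f x) & cdom e (g (f x))].
  by split; exact: chart_at_dom.
have s1 := sf c d ca da xc xd; have s2 := sg d e da ea xd xe.
have nd : \forall y \near c x, cdom d (f (cinv c y)).
  exact: cvg_cinv xc _ (fc _ (near_cdom xd)).
rewrite /mderiv -/c -/d -/e.
rewrite (@dirder_near _ _ _ _ ((e \o g \o cinv d) \o (d \o f \o cinv c))); last first.
  by apply: filterS nd => y yd; rewrite /= cfunK.
have dfx : (d \o f \o cinv c) (c x) = d (f x) by rewrite /= cfunK.
by rewrite dirder_comp// dfx.
Qed.

Lemma mderiv_linear M N (f : M -> N) x : hausdorff_space (mmodel N) ->
  msmooth_at f x -> linear (mderiv M N f x : mmodel M -> mmodel N).
Proof.
move=> hN [_ sf]; apply: dirder_linear => //.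
by apply: sf; [exact: chart_at_atlas|exact: chart_at_atlas|
  exact: chart_at_dom|exact: chart_at_dom].
Qed.

End SmoothMaps.

(** * Lie groups and their actions *)

Section LieGroupActions.
Variables (R : realType) (G : lie_group R).
Hypothesis hG : hausdorff_space (mmodel G).
Variable expG : lie_algebra G -> G.
Hypothesis expP : smooth_exponential expG.

Local Notation conjg g h := (lg_mul (lg_mul g h) (lg_inv g)).

Lemma lg_mulgV : right_inverse (lg_one G) (@lg_inv R G) (@lg_mul R G).
Proof.
move=> x; rewrite -[LHS]lg_mul1 -{1}(lg_mulV (lg_inv x)) -lg_mulA.
by rewrite [lg_mul (lg_inv x) _]lg_mulA lg_mulV lg_mul1 lg_mulV.
Qed.

Lemma lg_mulg1 : right_id (lg_one G) (@lg_mul R G).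
Proof. by move=> x; rewrite -(lg_mulV x) lg_mulA lg_mulgV lg_mul1. Qed.

Lemma expG0 xi : expG (0 *: xi) = lg_one G.
Proof.
have [_ expD _] := expP; set e := expG _.
have ee : e = lg_mul e e by rewrite /e -expD addr0.
by rewrite -[LHS]lg_mul1 -{1}(lg_mulV e) -lg_mulA -ee lg_mulV.
Qed.

Lemma expGN xi (t : R) : expG (- t *: xi) = lg_inv (expG (t *: xi)).
Proof.
have [_ expD _] := expP.
rewrite -[LHS]lg_mulg1 -(lg_mulgV (expG (t *: xi))) lg_mulA -expD addNr expG0.
by rewrite lg_mul1.
Qed.

Lemma msmooth_at_expG xi (t : R^o) :
  @msmooth_at R (vect_manifold R^o) G (fun s : R^o => expG (s *: xi)) t.
Proof.
have [sexp _ _] := expP.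
have s1 := @msmooth_at_vect R R^o (lie_algebra G) _ _ (smooth_at_scale xi t).
have s2 := @msmooth_msmooth_at R (vect_manifold (lie_algebra G)) G expG (t *: xi) sexp.
exact: (msmooth_at_comp s1 s2).
Qed.

Lemma velocity_expG xi :
  mderiv (vect_manifold R^o) G (fun t : R^o => expG (t *: xi)) 0 1 = xi :> mmodel G.
Proof. by have [_ _ vexp] := expP; exact: vexp xi. Qed.

(** Converts derivatives at the identity, as in [Ad], [ad] and [fundE], to derivatives along
    one-parameter subgroups. *)
Lemma mderiv_expG (N : manifold R) (f : G -> N) xi :
  hausdorff_space (mmodel N) -> msmooth_at f (lg_one G) ->
  mderiv (vect_manifold R^o) N (fun t : R^o => f (expG (t *: xi))) 0 1 =
  mderiv G N f (lg_one G) xi :> mmodel N.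
Proof.
move=> hN; rewrite -(expG0 xi) => sf.
have := @mderiv_comp R (vect_manifold R^o) G N (fun t : R^o => expG (t *: xi)) f
  0 1 hN (msmooth_at_expG xi 0) sf.
by rewrite velocity_expG.
Qed.

Lemma msmooth_at_mul2 (N : manifold R) (f g : N -> G) x :
  msmooth_at f x -> msmooth_at g x -> msmooth_at (fun y => lg_mul (f y) (g y)) x.
Proof. by move=> sf sg; apply: msmooth2_at => //; exact: lg_mul_smooth. Qed.

Lemma msmooth_at_inv (g : G) : msmooth_at (@lg_inv R G) g.
Proof. by apply: msmooth_msmooth_at; exact: lg_inv_smooth. Qed.

Lemma msmooth_at_id (N : manifold R) (x : N) : msmooth_at (fun y : N => y) x.
Proof.
apply: (@msmooth_at_charts _ _ _ _ _ (chart_at x) (chart_at x));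
  [exact: cvg_id|exact: chart_at_atlas|exact: chart_at_atlas|
   exact: chart_at_dom|exact: chart_at_dom|].
apply: smooth_at_near (smooth_at_id _).
apply: filterS (near_ccod (cfun_cod (chart_at_dom x))) => y yc.
by rewrite /= cinvK.
Qed.

Lemma msmooth_at_conjg (N : manifold R) (f g : N -> G) x :
  msmooth_at f x -> msmooth_at g x -> msmooth_at (fun y => conjg (f y) (g y)) x.
Proof.
move=> sf sg; apply: msmooth_at_mul2; first exact: msmooth_at_mul2.
by apply: (msmooth_at_comp sf); exact: msmooth_at_inv.
Qed.

Lemma conjg1 (g : G) : conjg g (lg_one G) = lg_one G.
Proof. by rewrite lg_mulg1 lg_mulgV. Qed.

Lemma msmooth_at_conjgr (g h : G) : msmooth_at (fun x => conjg g x) h.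
Proof. by apply: msmooth_at_conjg; [exact: msmooth_at_cst|exact: msmooth_at_id]. Qed.

Lemma Ad_linear (g : G) : linear (Ad g).
Proof. by apply: mderiv_linear => //; exact: msmooth_at_conjgr. Qed.

(** In the chart at the identity, [Ad g eta] is a partial derivative of conjugation, which is
    jointly smooth. As conjugation fixes the identity, this one chart serves as target for every
    [g]. *)
Lemma msmooth_at_Ad (eta : lie_algebra G) :
  @msmooth_at R G (vect_manifold (lie_algebra G)) (fun g => Ad g eta) (lg_one G).
Proof.
pose k := chart_at (lg_one G); pose F := mmodel G.
have ka : atlas k by exact: chart_at_atlas.
have k1 : cdom k (lg_one G) by exact: chart_at_dom.
pose B (p : F * F) := k (conjg (cinv k p.1) (cinv k p.2)).
have sB : smooth_at B (k (lg_one G), k (lg_one G)).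
  apply: (@msmooth_at_coord _ _ G
    (fun p : F * F => conjg (cinv k p.1) (cinv k p.2)) _ k) => //.
    by rewrite /= !cfunK // conjg1.
  apply: msmooth_at_conjg.
    apply: (@msmooth_at_comp _ (vect_manifold (F * F)%type) (vect_manifold F) G
      fst (cinv k)); first by apply: msmooth_at_vect; exact: smooth_at_fst.
    by apply: msmooth_at_cinv => //; exact: cfun_cod.
  apply: (@msmooth_at_comp _ (vect_manifold (F * F)%type) (vect_manifold F) G
    snd (cinv k)); first by apply: msmooth_at_vect; exact: smooth_at_snd.
  by apply: msmooth_at_cinv => //; exact: cfun_cod.
pose Phi (p : F) := dirder B (p, k (lg_one G)) (0, eta).
have sPhi : smooth_at Phi (k (lg_one G)).
  apply: (@smooth_at_comp _ F ((F * F) * (F * F))%type F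
    (fun p => ((p, k (lg_one G)), (0, eta)))
    (fun q => dirder B q.1 q.2)); last exact: smooth_at_dirder.
  by apply: smooth_at_pair; [apply: smooth_at_pair; [exact: smooth_at_id|]|];
    exact: smooth_at_cst.
have AdPhi p : Ad (cinv k p) eta = Phi p.
  by rewrite /Phi dirder_snd /Ad /mderiv conjg1.
apply: (@msmooth_at_near R G (vect_manifold F) (Phi \o k)).
  by apply: filterS (near_cdom k1) => g gk; rewrite /= -AdPhi cfunK.
apply: (@msmooth_at_comp R G (vect_manifold F) (vect_manifold F) k Phi).
  exact: msmooth_at_cfun.
exact: msmooth_at_vect.
Qed.

Lemma smooth_at_Ad_exp xi eta :
  smooth_at (fun t : R^o => Ad (expG (t *: xi)) eta) 0.
Proof.
apply: (@msmooth_at_coord _ R^o (vect_manifold (lie_algebra G)) _ _ (id_chart _)) => //.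
apply: (@msmooth_at_comp _ (vect_manifold R^o) G (vect_manifold (lie_algebra G))
  (fun t : R^o => expG (t *: xi)) (fun g => Ad g eta)).
  exact: msmooth_at_expG.
by rewrite expG0; exact: msmooth_at_Ad.
Qed.

Lemma ad_dirder xi eta :
  ad xi eta = dirder (fun t : R^o => Ad (expG (t *: xi)) eta) 0 1.
Proof.
rewrite /ad -(@mderiv_expG (vect_manifold (lie_algebra G))) //.
exact: msmooth_at_Ad.
Qed.

Lemma ad_linearl (eta : lie_algebra G) : linear (fun xi => ad xi eta).
Proof.
by apply: (mderiv_linear (N := vect_manifold (lie_algebra G))) => //;
  exact: msmooth_at_Ad.
Qed.

(** Each [Ad g] is linear, hence so are the difference quotients and their limit. *)
Lemma ad_linearr (xi : lie_algebra G) : linear (ad xi).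
Proof.
move=> a eta zeta; rewrite !ad_dirder; apply: dirderE => //.
rewrite /is_dirder.
rewrite (_ : (fun h : R => _) = (fun h : R => a *: (h^-1 *:
    (Ad (expG ((0 + h *: (1 : R^o)) *: xi)) eta - Ad (expG (0 *: xi)) eta)) +
    h^-1 *: (Ad (expG ((0 + h *: (1 : R^o)) *: xi)) zeta - Ad (expG (0 *: xi)) zeta))).
  apply: tvs_cvgD; last exact: smooth_at_is_dirder (smooth_at_Ad_exp xi zeta).
  apply: tvs_cvgZ; first exact: cvg_cst.
  exact: smooth_at_is_dirder (smooth_at_Ad_exp xi eta).
apply/funext => h; rewrite !Ad_linear [a *: (_ *: _)]scalerA [a * _]mulrC.
by rewrite -scalerA -scalerDr [a *: (_ - _)]scalerBr opprD addrACA.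
Qed.

(** [Ad (exp (t xi)) xi = xi]. *)
Lemma adxx (xi : lie_algebra G) : ad xi xi = 0.
Proof.
have [_ expD _] := expP; rewrite ad_dirder.
rewrite (_ : (fun t : R^o => _) = (fun=> xi)).
  apply: dirderE => //; rewrite /is_dirder subrr.
  by under eq_fun do rewrite scaler0; exact: cvg_cst.
apply/funext => t; rewrite /Ad.
have := @mderiv_expG G (fun h => conjg (expG (t *: xi)) h) xi hG
  (msmooth_at_conjgr _ _).
move=> <-; rewrite -[RHS]velocity_expG; apply: mderiv_near.
suff E s : conjg (expG (t *: xi)) (expG (s *: xi)) = expG (s *: xi).
  by apply: (@filterE _ (nbhs (0 : R^o))) => s; rewrite /= E.
rewrite -expGN -!expD.
by rewrite addrAC subrr add0r.
Qed.

Lemma ad_antisym (xi eta : lie_algebra G) : ad xi eta = - ad eta xi.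
Proof.
apply/eqP; rewrite -addr_eq0; apply/eqP.
have adDl (x y z : lie_algebra G) : ad (x + y) z = ad x z + ad y z.
  by have := ad_linearl z 1 x y; rewrite /= !scale1r.
have adDr (x y z : lie_algebra G) : ad x (y + z) = ad x y + ad x z.
  by have := ad_linearr x 1 y z; rewrite !scale1r.
by have := adxx (xi + eta); rewrite adDl !adDr !adxx add0r addr0.
Qed.

End LieGroupActions.

(** * Fundamental vector fields and orbits of one-parameter subgroups *)

Section Actions.
Variables (R : realType) (G : lie_group R) (M : manifold R).
Hypotheses (hG : hausdorff_space (mmodel G)) (hM : hausdorff_space (mmodel M)).
Variable expG : lie_algebra G -> G.
Hypothesis expP : smooth_exponential expG.
Variable act : G -> M -> M.
Hypothesis actP : smooth_action act.

Local Notation dot xi x := (fund act expG xi x).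

Lemma act1 x : act (lg_one G) x = x.
Proof. by have [] := actP. Qed.

Lemma actM g h x : act (lg_mul g h) x = act g (act h x).
Proof. by have [] := actP. Qed.

Lemma actVK g x : act (lg_inv g) (act g x) = x.
Proof. by rewrite -actM lg_mulV act1. Qed.

Lemma act_exp0 xi x : act (expG (0 *: xi)) x = x.
Proof. by rewrite expG0 ?act1. Qed.

Lemma msmooth_at_act (N : manifold R) (g : N -> G) (h : N -> M) x :
  msmooth_at g x -> msmooth_at h x -> msmooth_at (fun y => act (g y) (h y)) x.
Proof. by move=> sg sh; apply: msmooth2_at => //; have [] := actP. Qed.

Lemma msmooth_at_actr (g : G) x : msmooth_at (act g) x.
Proof. by apply: msmooth_at_act; [exact: msmooth_at_cst|exact: msmooth_at_id]. Qed.

Lemma msmooth_at_orbit x (g : G) : msmooth_at (fun g => act g x) g.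
Proof. by apply: msmooth_at_act; [exact: msmooth_at_id|exact: msmooth_at_cst]. Qed.

Lemma msmooth_at_flow xi x (t : R^o) :
  @msmooth_at R (vect_manifold R^o) M (fun s : R^o => act (expG (s *: xi)) x) t.
Proof.
apply: (@msmooth_at_act (vect_manifold R^o)); last exact: msmooth_at_cst.
exact: msmooth_at_expG.
Qed.

Lemma fundE xi x : dot xi x = mderiv G M (fun g => act g x) (lg_one G) xi.
Proof. by rewrite -(mderiv_expG expP)//; exact: msmooth_at_orbit. Qed.

Lemma fund_linear x : linear (fun xi => dot xi x : mmodel M).
Proof.
move=> a xi eta; rewrite !fundE.
by apply: mderiv_linear => //; exact: msmooth_at_orbit.
Qed.

Lemma smooth_at_fund x (xi : lie_algebra G) :
  smooth_at (fun xi => dot xi x : mmodel M) xi.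
Proof.
have [_ /(_ (chart_at (lg_one G)) (chart_at (act (lg_one G) x)))] :=
  msmooth_at_orbit x (lg_one G).
move=> /(_ (chart_at_atlas _) (chart_at_atlas _) (chart_at_dom _) (chart_at_dom _)).
set f := (f in smooth_at f _) => sf.
apply: (@smooth_at_near _ _ _ (fun v => dirder f (chart_at (lg_one G) (lg_one G)) v)).
  by apply: (@filterE _ (nbhs xi)) => v; rewrite fundE.
apply: (@smooth_at_comp _ (mmodel G) (mmodel G * mmodel G)%type _
  (fun v => (chart_at (lg_one G) (lg_one G), v)) (fun p => dirder f p.1 p.2)).
  by apply: smooth_at_pair; [exact: smooth_at_cst|exact: smooth_at_id].
exact: smooth_at_dirder.
Qed.

Lemma fund_chart xi x :
  dot xi x = dirder (fun t : R^o => chart_at x (act (expG (t *: xi)) x)) 0 1.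
Proof. by rewrite /fund /velocity0 /mderiv act_exp0. Qed.

(** Differentiate g . (h . x) = (g h g^-1) . (g . x) in [h] at the identity. *)
Lemma act_fund (g : G) eta x :
  mderiv M M (act g) x (dot eta x) = dot (Ad g eta) (act g x) :> mmodel M.
Proof.
pose c (h : G) := lg_mul (lg_mul g h) (lg_inv g).
have c1 : c (lg_one G) = lg_one G by rewrite /c conjg1.
have sc : msmooth_at c (lg_one G) by exact: msmooth_at_conjgr.
have so : msmooth_at (fun h => act h (act g x)) (c (lg_one G)).
  exact: msmooth_at_orbit.
have := mderiv_comp eta hM sc so; rewrite c1 -fundE => <-.
have so1 := msmooth_at_orbit x (lg_one G).
have := @mderiv_comp R _ _ _ (fun h => act h x) (act g) _ eta hM so1
  (msmooth_at_actr g _).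
rewrite -fundE act1 => <-; apply: mderiv_near.
by apply: (@filterE _ (nbhs _)) => h /=; rewrite /c !actM actVK.
Qed.

(** [t |-> exp (t sigma) . m] has velocity [T (exp (t sigma)) (sigma . m) = 0]. *)
Lemma near_act_exp_fixed sigma m : dot sigma m = 0 ->
  \forall t \near (0 : R^o), act (expG (t *: sigma)) m = m.
Proof.
move=> s0; pose k := chart_at m.
have ka : atlas k by exact: chart_at_atlas.
have mk : cdom k m by exact: chart_at_dom.
have [_ expD _] := expP.
have fc := msmooth_at_continuous (msmooth_at_flow sigma m 0).
rewrite act_exp0 in fc.
have nk : \forall t \near (0 : R^o), cdom k (act (expG (t *: sigma)) m).
  exact: fc _ (near_cdom mk).
have /nbhs_ballP[e /= e0 ek] := nk.
have kball t : `|t| < e -> cdom k (act (expG (t *: sigma)) m).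
  by move=> te; apply: ek; rewrite /ball /= sub0r normrN.
pose a t := k (act (expG (t *: sigma)) m).
have da t : `|t| < e -> is_dirder (a : R^o -> mmodel M) t 1 0.
  (* The one-parameter property moves the derivative at time [t] to time 0: the curve near [t] is
     [psi] applied to the curve near 0. *)
  move=> te; pose psi := k \o act (expG (t *: sigma)).
  have spsi : @msmooth_at R M (vect_manifold (mmodel M)) psi m.
    apply: (@msmooth_at_comp R M M (vect_manifold (mmodel M))).
      exact: msmooth_at_actr.
    by apply: msmooth_at_cfun => //; exact: kball.
  have sc := msmooth_at_flow sigma m 0.
  have := @mderiv_comp R (vect_manifold R^o) M (vect_manifold (mmodel M))
    (fun s : R^o => act (expG (s *: sigma)) m) psi 0 1 hM sc.
  rewrite act_exp0 => /(_ spsi).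
  have -> : mderiv (vect_manifold R^o) M (fun s : R^o => act (expG (s *: sigma)) m) 0 1
    = 0 :> mmodel M by exact: s0.
  have -> : mderiv M (vect_manifold (mmodel M)) psi m 0 = 0 :> mmodel M.
    have := @mderiv_linear R M (vect_manifold (mmodel M)) psi m hM spsi (-1) 0 0.
    by rewrite scaler0 addr0 scaleN1r addNr.
  rewrite mderiv_vect => d0.
  have sps : smooth_at (psi \o (fun s : R^o => act (expG (s *: sigma)) m)) 0.
    apply: (@msmooth_at_coord R R^o (vect_manifold (mmodel M)) _ _ (id_chart _)) => //.
    apply: (@msmooth_at_comp R (vect_manifold R^o) M (vect_manifold (mmodel M))
      (fun s : R^o => act (expG (s *: sigma)) m) psi) => //.
    by rewrite act_exp0.
  have := smooth_at_is_dirder (1 : R^o) sps; rewrite d0.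
  rewrite /is_dirder.
  suff -> : (fun h : R => h^-1 *: ((psi \o (fun s : R^o => act (expG (s *: sigma)) m))
    (0 + h *: (1 : R^o)) - (psi \o (fun s : R^o => act (expG (s *: sigma)) m)) 0)) =
    (fun h : R => h^-1 *: (a (t + h *: (1 : R^o)) - a t)) by [].
  apply/funext => h; rewrite /psi /a /= -!actM -!expD add0r.
  by rewrite addr0.
apply/nbhs_ballP; exists e => //= t; rewrite /ball /= sub0r normrN => te.
have := dirder0_cst hM da te.
have [t_k k0] := (kball t te, mk).
by rewrite /a act_exp0 => /(congr1 (cinv k)); rewrite !cfunK.
Qed.

End Actions.

(** * The linearized action at a zero of a fundamental field *)

Section Isotropy.
Variables (R : realType) (G : lie_group R) (M : manifold R).
Hypotheses (hG : hausdorff_space (mmodel G)) (hM : hausdorff_space (mmodel M)).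
Variable expG : lie_algebra G -> G.
Hypothesis expP : smooth_exponential expG.
Variable act : G -> M -> M.
Hypothesis actP : smooth_action act.
Variables (m : M) (sigma : lie_algebra G).

Local Notation dot xi x := (fund act expG xi x).
Local Notation E := (mmodel M).
Local Notation k := (chart_at m).
Local Notation y0 := (chart_at m m).

Let ka : atlas k. Proof. exact: chart_at_atlas. Qed.
Let mk : cdom k m. Proof. exact: chart_at_dom. Qed.

Definition flow_chart (p : R^o * E) : E :=
  k (act (expG (p.1 *: sigma)) (cinv k p.2)).

(** The fundamental field of [sigma] in the chart at [m]. Unlike [fund sigma x], whose coordinates
    refer to the preferred chart at [x], it depends smoothly on the point. *)
Definition fund_field (y : E) : E := dirder flow_chart (0, y) (1, 0).

(** The operator [tau_m sigma^*] as the derivative of that field at its zero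
    [m]; symmetry of second derivatives identifies it with the derivative of
    the isotropy action. *)
Definition isotropy (v : E) : E := dirder fund_field y0 v.

(** When [sigma] vanishes at [m], this is for small times the isotropy action of [expG (t *: sigma)]
    on T_m M, here as a map jointly smooth in time and vector. *)
Definition flow_deriv (p : R^o * E) : E := dirder flow_chart (p.1, y0) (0, p.2).

Lemma msmooth_at_flow2 (p : R^o * E) : ccod k p.2 ->
  @msmooth_at R (vect_manifold (R^o * E)%type) M
    (fun p : R^o * E => act (expG (p.1 *: sigma)) (cinv k p.2)) p.
Proof.
move=> pk; apply: (msmooth_at_act actP).
  apply: (@msmooth_at_comp R (vect_manifold (R^o * E)%type) (vect_manifold R^o) G
    fst (fun t : R^o => expG (t *: sigma))); last exact: msmooth_at_expG.
  by apply: msmooth_at_vect; exact: smooth_at_fst.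
apply: (@msmooth_at_comp R (vect_manifold (R^o * E)%type) (vect_manifold E) M
  snd (cinv k)); last exact: msmooth_at_cinv.
by apply: msmooth_at_vect; exact: smooth_at_snd.
Qed.

Lemma smooth_at_flow_chart (y : E) : ccod k y -> smooth_at flow_chart (0, y).
Proof.
move=> yk; apply: (@msmooth_at_coord _ _ _ (fun p : R^o * E =>
  act (expG (p.1 *: sigma)) (cinv k p.2)) _ k) => //.
  by rewrite /= (act_exp0 expP actP); exact: cinv_dom.
exact: msmooth_at_flow2.
Qed.

Lemma smooth_at_fund_field y : ccod k y -> smooth_at fund_field y.
Proof.
move=> yk; apply: (@smooth_at_comp _ E ((R^o * E) * (R^o * E))%type E
  (fun y => ((0 : R^o, y), (1 : R^o, 0 : E)))
  (fun q => dirder flow_chart q.1 q.2)).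
  by apply: smooth_at_pair; [apply: smooth_at_pair; [|exact: smooth_at_id]|];
    exact: smooth_at_cst.
by apply: smooth_at_dirder => //; exact: smooth_at_flow_chart.
Qed.

Lemma fund_fieldE y :
  fund_field y = dirder (fun t : R^o => k (act (expG (t *: sigma)) (cinv k y))) 0 1.
Proof. by rewrite /fund_field dirder_fst. Qed.

Lemma fund_field0 : fund_field y0 = dot sigma m.
Proof. by rewrite fund_fieldE cfunK // (fund_chart expP actP). Qed.

(** Links the field in the chart at [m] to [fund], so that the momentum equation can be applied at
    points near [m]. *)
Lemma mderiv_cinv_fund_field y : ccod k y ->
  mderiv (vect_manifold E) M (cinv k) y (fund_field y) =
  dot sigma (cinv k y) :> E.
Proof.
move=> yk; pose x := cinv k y.
have xk : cdom k x by exact: cinv_dom.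
pose c (t : R^o) := act (expG (t *: sigma)) x.
have c0 : c 0 = x by rewrite /c (act_exp0 expP actP).
have sc := msmooth_at_flow expP actP sigma x 0.
have skc : @msmooth_at R (vect_manifold R^o) (vect_manifold E) (k \o c) 0.
  apply: (@msmooth_at_comp R (vect_manifold R^o) M (vect_manifold E) c k) => //.
  by apply: msmooth_at_cfun; rewrite // c0.
have kc0 : (k \o c) 0 = y by rewrite /= c0 /x cinvK.
have := @mderiv_comp R (vect_manifold R^o) (vect_manifold E) M (k \o c) (cinv k)
  0 1 hM skc.
rewrite kc0 => /(_ (msmooth_at_cinv ka yk)).
rewrite mderiv_vect -[dirder (k \o c) 0 1]fund_fieldE => <-.
rewrite /fund /velocity0; apply: mderiv_near.
have cc : c @ (0 : R^o) --> c 0 := msmooth_at_continuous sc.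
rewrite c0 in cc; have nk : \forall t \near (0 : R^o), cdom k (c t).
  exact: cc _ (near_cdom xk).
by apply: filterS nk => t tk; rewrite /= cfunK.
Qed.

Lemma smooth_at_flow_deriv v : smooth_at flow_deriv (0, v).
Proof.
apply: (@smooth_at_comp _ (R^o * E)%type ((R^o * E) * (R^o * E))%type E
  (fun p : R^o * E => ((p.1, y0), (0 : R^o, p.2)))
  (fun q => dirder flow_chart q.1 q.2)).
  apply: smooth_at_pair; apply: smooth_at_pair;
    by [exact: smooth_at_fst|exact: smooth_at_snd|exact: smooth_at_cst].
by apply: smooth_at_dirder => //; apply: smooth_at_flow_chart; exact: cfun_cod.
Qed.

Lemma flow_deriv0 v : flow_deriv (0, v) = v.
Proof.
rewrite /flow_deriv dirder_snd.
rewrite (@dirder_near _ _ _ _ id); first exact: dirder_of_linear.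
apply: filterS (near_ccod (cfun_cod mk)) => y yk.
by rewrite /flow_chart /= (act_exp0 expP actP) cinvK.
Qed.

Lemma dirder_flow_deriv v : dirder flow_deriv (0, v) (1, 0) = isotropy v.
Proof.
rewrite dirder_fst /flow_deriv /isotropy /fund_field /=.
have sf := smooth_at_flow_chart (cfun_cod mk).
have := @schwarz R _ _ flow_chart (0, y0) (0, v) (1, 0) hM sf.
by rewrite dirder_fst dirder_snd.
Qed.

Lemma isotropy_linear : linear isotropy.
Proof.
apply: dirder_linear => //; apply: smooth_at_fund_field; exact: cfun_cod.
Qed.

Hypothesis sigma_m : dot sigma m = 0.

Lemma near_flow_deriv : \forall t \near (0 : R^o), forall v,
  flow_deriv (t, v) = mderiv M M (act (expG (t *: sigma))) m v.
Proof.
apply: filterS (near_act_exp_fixed hM expP actP sigma_m) => t tm v.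
by rewrite /flow_deriv dirder_snd /mderiv tm.
Qed.

(** As [expG (t *: sigma)] fixes [m] for small [t], [act_fund] says that it sends eta . m to (Ad
    eta) . m; differentiate at t = 0. *)
Lemma isotropy_fund eta : isotropy (dot eta m) = dot (ad sigma eta) m.
Proof.
rewrite -dirder_flow_deriv dirder_fst.
rewrite (@dirder_near _ _ _ _ ((fun xi => dot xi m : E) \o
  (fun t : R^o => Ad (expG (t *: sigma)) eta))).
  rewrite dirder_comp //.
  - rewrite -ad_dirder //; apply: dirder_of_linear => //.
    exact: fund_linear.
  - exact: smooth_at_Ad_exp.
  - exact: smooth_at_fund.
near=> t.
have -> : flow_deriv (t, dot eta m) =
    mderiv M M (act (expG (t *: sigma))) m (dot eta m).
  by near: t; have := near_flow_deriv; apply: filterS => t dt; exact: dt.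
rewrite (act_fund hM expP actP) /=.
suff -> : act (expG (t *: sigma)) m = m by [].
near: t; have := near_act_exp_fixed hM expP actP sigma_m.
by apply: filterS => t dt; exact: dt.
Unshelve. all: by end_near. Qed.

(** Near t = 0 both the group element and its inverse fix [m], so only [j m] occurs and the curve is
    A_t j A_(-t) X - j X, with A_t the isotropy action; the claim is the product rule. *)
Lemma tau_acs'E (j : endo_field M) (X : E) :
  linear (j m : E -> E) -> continuous (j m : E -> E) ->
  tau_acs' act expG j sigma (X : tangent m) =
  isotropy (j m X) - j m (isotropy X) :> E.
Proof.
move=> jl jc; rewrite /tau_acs' /ddt0.
have near_fix := near_act_exp_fixed hM expP actP sigma_m.
have oppc : (fun t : R^o => - t) @ (0 : R^o) --> (0 : R^o).
  by have := @opp_continuous R^o 0; rewrite /continuous_at oppr0.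
have near_fix' : \forall t \near (0 : R^o), act (expG (- t *: sigma)) m = m.
  exact: oppc _ near_fix.
have near_dN : \forall t \near (0 : R^o), forall v,
    flow_deriv (- t, v) = mderiv M M (act (expG (- t *: sigma))) m v.
  exact: oppc _ near_flow_deriv.
(* Time enters twice, as the time of the outer action and inside the vector acted on; the chain rule
   through [h] separates the two contributions. *)
pose h (t : R^o) : R^o * E := (t, j m (flow_deriv (- t, X))).
rewrite (@dirder_near _ _ _ _ (fun t : R^o => flow_deriv (h t) + - j m X)); last first.
  near=> t.
  have tm : act (expG (t *: sigma)) m = m by near: t.
  have tm' : act (lg_inv (expG (t *: sigma))) m = m.
    by rewrite -expGN//; near: t.
  rewrite /tau_acs /h tm'.
  have -> : mderiv M M (act (lg_inv (expG (t *: sigma)))) m X =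
      flow_deriv (- t, X) :> E.
    rewrite -expGN//; apply/esym; near: t.
    by have := near_dN; apply: filterS => t dt; exact: dt.
  congr (_ - _); apply/esym; near: t.
  by have := near_flow_deriv; apply: filterS => t dt; exact: dt.
have sN : smooth_at (fun t : R^o => (- t, X)) 0.
  apply: smooth_at_pair; last exact: smooth_at_cst.
  apply: smooth_at_linear => [a t u|t]; first by rewrite scalerN opprD.
  exact: opp_continuous.
have sNX : smooth_at (fun t : R^o => flow_deriv (- t, X)) 0.
  apply: (@smooth_at_comp _ R^o (R^o * E)%type E (fun t : R^o => (- t, X)) flow_deriv) => //.
  by rewrite oppr0; exact: smooth_at_flow_deriv.
have sj v : smooth_at (j m : E -> E) v by exact: smooth_at_linear.
have sjN : smooth_at (fun t : R^o => j m (flow_deriv (- t, X)) : E) 0.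
  exact: (@smooth_at_comp _ R^o E E (fun t : R^o => flow_deriv (- t, X)) (j m)).
have sh : smooth_at h 0 by apply: smooth_at_pair => //; exact: smooth_at_id.
have h0 : h 0 = (0, j m X) by rewrite /h oppr0 flow_deriv0.
have sfh : smooth_at (flow_deriv \o h) 0.
  by apply: smooth_at_comp => //; rewrite h0; exact: smooth_at_flow_deriv.
have dN : dirder (fun t : R^o => flow_deriv (- t, X)) 0 1 = - isotropy X.
  have -> : (fun t : R^o => flow_deriv (- t, X)) =
    flow_deriv \o (fun t : R^o => (- t, X)) by [].
  rewrite dirder_comp //=; last by rewrite oppr0; exact: smooth_at_flow_deriv.
  have -> : dirder (fun t : R^o => (- t, X)) 0 1 = (-1) *: (1 : R^o, 0 : E).
    apply: dirderE; first by apply: hausdorff_prod => //; exact: Rhausdorff.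
    rewrite (_ : _ *: _ = (-1 : R^o, 0 : E)); last first.
      by congr (_, _); rewrite /= ?scaler0 // scaleN1r.
    apply: is_dirder_pair; last exact: is_dirder_cst.
    by apply: is_dirder_linear => a t u; rewrite scalerN opprD.
  rewrite oppr0 dirder_scale //; last exact: smooth_at_flow_deriv.
  by rewrite dirder_flow_deriv scaleN1r.
have jN v : j m (- v) = - j m v :> E.
  by have := jl (-1) v 0; rewrite scaleN1r addr0 => ->; have := jl (-1) 0 0;
    rewrite scaler0 addr0 scaleN1r addNr => ->; rewrite addr0 scaleN1r.
have dh : dirder h 0 1 = (1 : R^o, - j m (isotropy X)).
  rewrite /h dirder_pair//; try by [exact: Rhausdorff|exact: smooth_at_id].
  congr (_, _); first by apply: dirder_of_linear => //; exact: Rhausdorff.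
  have -> : (fun t : R^o => j m (flow_deriv (- t, X)) : E) =
    (j m : E -> E) \o (fun t : R^o => flow_deriv (- t, X)) by [].
  by rewrite dirder_comp // dN dirder_of_linear.
have -> : dirder (fun t : R^o => flow_deriv (h t) + - j m X) 0 1 =
    dirder (flow_deriv \o h) 0 1.
  apply: dirderE => //; rewrite -[X in is_dirder _ _ _ X]addr0.
  by apply: is_dirderD; [exact: smooth_at_is_dirder|exact: is_dirder_cst].
rewrite dirder_comp // ?h0; last exact: smooth_at_flow_deriv.
rewrite dh.
have -> : (1 : R^o, - j m (isotropy X) : E) = (1, 0) + (0, - j m (isotropy X)).
  by congr (_, _); rewrite /= ?addr0 ?add0r.
rewrite dirderD //; last exact: smooth_at_flow_deriv.
rewrite dirder_flow_deriv dirder_snd; congr (_ + _).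
rewrite (_ : (fun z => _) = id); first exact: dirder_of_linear.
by apply/funext => v; rewrite flow_deriv0.
Unshelve. all: by end_near. Qed.

End Isotropy.

(** * The Hessian of the squared norm of a momentum map *)

Section SmoothOn.
Variables (R : realType).

Lemma smooth_at_on (E F : tvsType R) (U : set E) (f : E -> F) :
  hausdorff_space F -> (forall x, U x -> smooth_at f x) -> smooth_on U f.
Proof.
move=> hF sf n; elim: n E U f sf => [|n IHn] E U f sf; split;
  try by move=> x /sf/smooth_at_continuous.
  by [].
exists (dirder f); split; first by move=> x v /sf/smooth_at_is_dirder.
by apply: IHn => -[x v] /= /sf; exact: smooth_at_dirder.
Qed.

Lemma msmooth_at_on (M N : manifold R) (U : set M) (f : M -> N) :
  hausdorff_space (mmodel N) -> (forall x, U x -> msmooth_at f x) ->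
  msmooth_on U f.
Proof.
move=> hN sf; split; first by move=> x /sf[].
move=> c d ca da; apply: smooth_at_on => // y [x [[Ux xc] xd] <-].
by have [_] := sf x Ux; apply.
Qed.

Lemma is_dirder_cvg (E F : tvsType R) (f : E -> F) (x v : E) l :
  is_dirder f x v l -> (fun h : R => f (x + h *: v)) @ (0 : R)^' --> f x.
Proof.
move=> dl; have h0 : (fun h : R => h) @ (0 : R)^' --> (0 : R) by exact: cvg_within.
have fx : (fun _ : R => f x) @ (0 : R)^' --> f x by exact: cvg_cst.
have fl : (fun h : R => f x + h *: (h^-1 *: (f (x + h *: v) - f x))) @ (0 : R)^'
    --> f x + 0 *: l by apply: tvs_cvgD => //; exact: tvs_cvgZ.
rewrite scale0r addr0 in fl.
refine (cvg_trans _ fl); apply: near_eq_cvg; near=> h.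
have hn0 : h != 0 by near: h; exact: nbhs_dnbhs_neq.
by rewrite scalerA mulfV// scale1r [f x + _]addrC subrK.
Unshelve. all: by end_near. Qed.

Lemma derive1_is_dirder (f : R -> R) (t l : R) :
  is_dirder (f : R^o -> R^o) t 1 l -> derive1 (f : R -> R^o) t = l.
Proof.
move=> dl; rewrite /derive1; apply: cvg_lim; first exact: Rhausdorff.
have -> : (fun h : R => h^-1 *: ((f (h + t) : R^o) - f t)) =
  (fun h : R => h^-1 *: ((f (t + h *: (1 : R^o)) : R^o) - f t)).
  by apply/funext => h; rewrite [h *: (1 : R^o)]mulr1 [h + t]addrC.
exact: dl.
Qed.

End SmoothOn.

Section Pairing.
Variables (R : realType) (V : tvsType R) (kappa : V -> V -> R).
Hypothesis kl : forall v, scalar (kappa ^~ v).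
Hypothesis kC : forall u v, kappa u v = kappa v u.
Hypothesis kc : continuous (fun p : V * V => kappa p.1 p.2).

Lemma kappaDl u v x : kappa (u + v) x = kappa u x + kappa v x.
Proof. by have := kl x 1 u v; rewrite scale1r mul1r. Qed.

Lemma kappaZl (a : R) u x : kappa (a *: u) x = a * kappa u x.
Proof.
have k0 : kappa 0 x = 0.
  by have := kl x (-1) 0 0; rewrite scaler0 addr0 mulN1r addNr.
by have := kl x a u 0; rewrite addr0 k0 addr0.
Qed.

Lemma kappaDr x u v : kappa x (u + v) = kappa x u + kappa x v.
Proof. by rewrite !(kC x) kappaDl. Qed.

Lemma kappaZr x (a : R) u : kappa x (a *: u) = a * kappa x u.
Proof. by rewrite !(kC x) kappaZl. Qed.

Lemma kappaNl u x : kappa (- u) x = - kappa u x.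
Proof. by rewrite -scaleN1r kappaZl mulN1r. Qed.

Lemma kappaNr x u : kappa x (- u) = - kappa x u.
Proof. by rewrite !(kC x) kappaNl. Qed.

Lemma kappaBl u v x : kappa (u - v) x = kappa u x - kappa v x.
Proof. by rewrite kappaDl kappaNl. Qed.

Lemma kappaBr x u v : kappa x (u - v) = kappa x u - kappa x v.
Proof. by rewrite kappaDr kappaNr. Qed.

Lemma cvg_kappa (T : Type) (D : set_system T) {FD : Filter D} (f g : T -> V) a b :
  f @ D --> a -> g @ D --> b -> (fun t => kappa (f t) (g t)) @ D --> kappa a b.
Proof.
move=> fa gb; have fg : (fun t => (f t, g t)) @ D --> (a, b).
  by have := cvg_pair fa gb; exact.
have kab : (fun p : V * V => kappa p.1 p.2) @ (a, b) --> kappa a b := @kc (a, b).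
exact: (cvg_comp _ _ fg kab).
Qed.

(** The quotient splits into [kappa] of the quotient of [f] with the displaced [g], plus [kappa] of
    [f x] with the quotient of [g]; joint continuity of [kappa] gives the limit. *)
Lemma is_dirder_kappa (E : tvsType R) (f g : E -> V) (x v : E) l l' :
  is_dirder f x v l -> is_dirder g x v l' ->
  is_dirder (fun y => kappa (f y) (g y) : R^o) x v
    (kappa l (g x) + kappa (f x) l').
Proof.
move=> df dg; rewrite /is_dirder.
have -> : (fun h : R => h^-1 *: ((kappa (f (x + h *: v)) (g (x + h *: v)) : R^o)
     - kappa (f x) (g x))) =
  (fun h : R => (kappa (h^-1 *: (f (x + h *: v) - f x)) (g (x + h *: v)) : R^o) +
     kappa (f x) (h^-1 *: (g (x + h *: v) - g x))).
  apply/funext => h; rewrite kappaZl kappaZr -mulrDr kappaBl kappaBr.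
  by rewrite addrA subrK.
apply: (@tvs_cvgD _ _ _ _ R^o).
  by apply: cvg_kappa => //; exact: is_dirder_cvg dg.
by apply: cvg_kappa => //; exact: cvg_cst.
Qed.

End Pairing.

Section Hessian.
Variables (R : realType) (G : lie_group R) (M : manifold R).
Hypotheses (hG : hausdorff_space (mmodel G)) (hM : hausdorff_space (mmodel M)).
Variable expG : lie_algebra G -> G.
Hypothesis expP : smooth_exponential expG.
Variable act : G -> M -> M.
Hypothesis actP : smooth_action act.
Variable w : two_tensor M.
Hypothesis wP : symplectic_form w.
Variable kappa : lie_algebra G -> lie_algebra G -> R.
Hypothesis kappaP : pairing kappa.
Variable J : M -> lie_algebra G.
Hypothesis JP : momentum_map act expG w kappa J.
Variable m : M.

Local Notation dot xi x := (fund act expG xi x).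
Local Notation E := (mmodel M).
Local Notation k := (chart_at m).
Local Notation y0 := (chart_at m m).
Local Notation sigma := (J m).
Local Notation W := (tensor_in_chart w k).
Local Notation tau := (isotropy expG act m sigma).
Local Notation field := (fund_field expG act m sigma).

Let ka : atlas k. Proof. exact: chart_at_atlas. Qed.
Let mk : cdom k m. Proof. exact: chart_at_dom. Qed.
Let y0k : ccod k y0. Proof. exact: cfun_cod. Qed.
Let kl v : scalar (kappa ^~ v). Proof. by case: kappaP => + _ _ _; exact. Qed.
Let kC u v : kappa u v = kappa v u. Proof. by case: kappaP. Qed.
Let kc : continuous (fun p : lie_algebra G * lie_algebra G => kappa p.1 p.2).
Proof. by case: kappaP. Qed.

Definition Jchart (y : E) : lie_algebra G := J (cinv k y).

Lemma msmooth_at_J x : @msmooth_at R M (vect_manifold (lie_algebra G)) J x.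
Proof. by apply: msmooth_msmooth_at; case: JP. Qed.

Lemma smooth_at_Jchart y : ccod k y -> smooth_at Jchart y.
Proof.
move=> yk; apply: (@msmooth_at_coord R E (vect_manifold (lie_algebra G)) _ _
  (id_chart _)) => //.
apply: (@msmooth_at_comp R (vect_manifold E) M (vect_manifold (lie_algebra G))
  (cinv k) J); first exact: msmooth_at_cinv.
exact: msmooth_at_J.
Qed.

Lemma mderiv_cinv0 (v : E) : mderiv (vect_manifold E) M (cinv k) y0 v = v :> E.
Proof.
rewrite /mderiv /= cfunK // (@dirder_near _ _ _ _ id); first exact: dirder_of_linear.
by apply: filterS (near_ccod y0k) => y yk; rewrite /= cinvK.
Qed.

Lemma tensor_in_chart0 (u v : E) : W y0 u v = @w m u v.
Proof.
rewrite /tensor_in_chart !mderiv_cinv0.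
(* All tangent spaces are convertible to [E], so the foot point alone can be replaced. *)
have wE x x' (a b : E) : x = x' -> @w x a b = @w x' a b by move=> ->.
exact: wE (cfunK mk).
Qed.

Lemma tensor_in_chartZ y (a : R) (u v : E) : ccod k y ->
  W y (a *: u) v = a * W y u v.
Proof.
move=> yk; have lin := mderiv_linear hM (msmooth_at_cinv ka yk).
have wl := form_linear wP (mderiv (vect_manifold E) M (cinv k) y v).
rewrite /tensor_in_chart.
have dZ : mderiv (vect_manifold E) M (cinv k) y (a *: u) =
    a *: mderiv (vect_manifold E) M (cinv k) y u + 0 :> E.
  have d0 : mderiv (vect_manifold E) M (cinv k) y 0 = 0 :> E.
    by have := lin (-1) 0 0; rewrite scaler0 addr0 scaleN1r addNr.
  by rewrite -d0 -lin addr0.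
rewrite dZ wl.
have -> : @w (cinv k y) 0 (mderiv (vect_manifold E) M (cinv k) y v) = 0.
  by have := wl (-1) 0 0; rewrite scaler0 addr0 mulN1r addNr.
by rewrite addr0.
Qed.

Lemma cvg_tensor_in_chart (T : Type) (D : set_system T) {FD : Filter D}
    (y u v : T -> E) (a b : E) :
  y @ D --> y0 -> u @ D --> a -> v @ D --> b ->
  (fun t => W (y t) (u t) (v t) : R^o) @ D --> (@w m a b : R^o).
Proof.
move=> yc uc vc.
have uvc : (fun t => (u t, v t)) @ D --> (a, b) by have := cvg_pair uc vc; exact.
have yuvc : (fun t => (y t, (u t, v t))) @ D --> (y0, (a, b)).
  by have := cvg_pair yc uvc; exact.
have [+ _] := form_smooth wP ka 0%N.
move=> /(_ (y0, (a, b)) y0k) Wc.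
rewrite -(tensor_in_chart0 a b).
exact: (cvg_comp _ _ yuvc Wc).
Qed.

Lemma momentum_chart y (v : E) : ccod k y ->
  kappa (dirder Jchart y v) sigma = - W y (field y) v.
Proof.
move=> yk; have [_ mom] := JP.
pose X : E := mderiv (vect_manifold E) M (cinv k) y v.
have := mom sigma (cinv k y) X.
rewrite -(mderiv_cinv_fund_field hM expP actP _ yk).
have <- : dirder Jchart y v = TJ J (X : tangent (cinv k y)).
  by rewrite /TJ /X -(@mderiv_comp R (vect_manifold E) M (vect_manifold _)) //;
    [exact: msmooth_at_cinv|exact: msmooth_at_J].
by move=> /eqP; rewrite addrC addr_eq0 => /eqP.
Qed.

Lemma normsq_dirder (y v : E) : ccod k y ->
  is_dirder (fun y => normsq kappa J (cinv k y) : R^o) y v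
    (2 * kappa (dirder Jchart y v) (Jchart y)).
Proof.
move=> yk; have dJ := smooth_at_is_dirder v (smooth_at_Jchart yk).
have := is_dirder_kappa kl kC kc dJ dJ.
by rewrite [kappa (Jchart y) _]kC -mulr2n mulr_natl.
Qed.

(** The differential of [normsq] at [m] is 2 kappa (TJ X, sigma) = - 2 w (sigma . m, X). *)
Lemma critical_fixed : critical (normsq kappa J) m -> dot sigma m = 0.
Proof.
move=> crit; apply: (form_nondeg wP) => X; have [_ mom] := JP.
have := crit X; rewrite /mderiv /= (dirderE _ (@normsq_dirder y0 X y0k)); last first.
  exact: Rhausdorff.
move=> /eqP; rewrite mulf_eq0 pnatr_eq0 /= {2}/Jchart cfunK // => /eqP kX.
have := mom sigma m X.
by rewrite (_ : TJ J X = dirder Jchart y0 X)// kX addr0.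
Qed.

Hypothesis sigma_m : dot sigma m = 0.

Let field0 : field y0 = 0.
Proof. by rewrite fund_field0. Qed.

Lemma momentum_chart0 v : kappa (dirder Jchart y0 v) sigma = 0.
Proof.
by rewrite momentum_chart // field0 -(scale0r 0) tensor_in_chartZ // mul0r oppr0.
Qed.

(** As [field] vanishes at [y0], only its derivative contributes to the
    second-order expansion of [kappa (J _) sigma]. *)
Lemma cvg_momentum_chart (y v : R^o -> E) (X : E) :
  smooth_at y 0 -> y 0 = y0 -> v @ (0 : R)^' --> X ->
  (fun h : R => h^-1 * kappa (dirder Jchart (y h) (v h)) sigma : R^o) @ (0 : R)^'
    --> (- @w m (tau (dirder y 0 1)) X : R^o).
Proof.
move=> sy yE vX.
have yc : y @ (0 : R)^' --> y0.
  have := smooth_at_continuous sy; rewrite /prop_for /continuous_at yE => yc.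
  exact: cvg_trans (cvg_app _ (@cvg_within _ _ _ _)) yc.
have sf : smooth_at field (y 0) by rewrite yE; exact: smooth_at_fund_field.
have sfy := smooth_at_comp sy sf.
have df := smooth_at_is_dirder (1 : R^o) sfy.
have dfE : dirder (field \o y) 0 1 = tau (dirder y 0 1).
  by rewrite dirder_comp // yE.
rewrite dfE in df.
have fc : (fun h : R => h^-1 *: field (y h)) @ (0 : R)^' --> tau (dirder y 0 1).
  refine (cvg_trans _ df); apply: near_eq_cvg; near=> h.
  by rewrite /= add0r yE field0 subr0 [h *: (1 : R^o)]mulr1.
(* Linearity in the first slot absorbs [h^-1] into the field, and joint continuity of [W] does the
   rest. *)
have Wc : (fun h => W (y h) (h^-1 *: field (y h)) (v h) : R^o) @ (0 : R)^' -->
    (@w m (tau (dirder y 0 1)) X : R^o) by exact: cvg_tensor_in_chart.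
have : (fun h => - (W (y h) (h^-1 *: field (y h)) (v h)) : R^o) @ (0 : R)^' -->
    (- @w m (tau (dirder y 0 1)) X : R^o) 
  by exact: (cvg_comp _ _ Wc (@opp_continuous R^o _)).
move=> WNc; refine (cvg_trans _ WNc); apply: near_eq_cvg; near=> h.
have yhk : ccod k (y h) by near: h; exact: yc _ (near_ccod y0k).
by rewrite tensor_in_chartZ // momentum_chart // mulrN.
Unshelve. all: by end_near. Qed.

(** The preceding limit along the straight line through [y0] with velocity [Y] and constant vector
    [X] is a second derivative of [kappa (Jchart _) sigma]. *)
Lemma tau_second_derivative (X Y : E) :
  @w m (tau Y) X = - kappa (dirder (fun y => dirder Jchart y X) y0 Y) sigma.
Proof.
pose y (t : R^o) := y0 + t *: Y.
have sy : smooth_at y 0 by apply: smooth_atD; [exact: smooth_at_cst|exact: smooth_at_scale].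
have yE : y 0 = y0 by rewrite /y scale0r addr0.
have dy : dirder y 0 1 = Y.
  apply: dirderE => //; rewrite -[X in is_dirder _ _ _ X]add0r.
  apply: is_dirderD; first exact: is_dirder_cst.
  rewrite -[X in is_dirder _ _ _ X](scale1r Y).
  apply: (@is_dirder_linear _ _ _ (fun t : R^o => t *: Y)) => a t u.
  by rewrite scalerDl scalerA.
have Xc : (fun _ : R => X) @ (0 : R)^' --> X by exact: cvg_cst.
have := cvg_momentum_chart sy yE Xc; rewrite dy => c1.
have sJ : smooth_at (fun y => dirder Jchart y X) y0.
  apply: (@smooth_at_comp _ E (E * E)%type _ (fun y => (y, X))
    (fun p => dirder Jchart p.1 p.2)).
    by apply: smooth_at_pair; [exact: smooth_at_id|exact: smooth_at_cst].
  by apply: smooth_at_dirder => //; exact: smooth_at_Jchart.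
have dk := is_dirder_kappa kl kC kc (smooth_at_is_dirder Y sJ)
  (is_dirder_cst sigma y0 Y).
have k0 : kappa (dirder Jchart y0 X) 0 = 0.
  by rewrite -(scale0r 0) kappaZr // mul0r.
rewrite k0 addr0 in dk.
suff /eqP : - @w m (tau Y) X = kappa (dirder (fun y => dirder Jchart y X) y0 Y) sigma.
  by rewrite eqr_oppLR => /eqP.
apply: (cvg_unique (@Rhausdorff R) c1).
refine (cvg_trans _ dk); apply: near_eq_cvg; near=> h.
by rewrite /= momentum_chart0 subr0.
Unshelve. all: by end_near. Qed.

Lemma tau_sym (X Y : E) : @w m (tau Y) X = @w m (tau X) Y.
Proof.
by rewrite !tau_second_derivative schwarz//; exact: smooth_at_Jchart.
Qed.

(** With u = J o g, the first derivative is 2 kappa (u', u). Since kappa (u' 0, sigma) = 0, its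
    quotient at 0 is twice kappa (u' h, (u h - u 0) / h) + kappa (u' h, sigma) / h. The first term
    tends to kappa (TJ X, TJ X), the second to - w (tau X, X) by [cvg_momentum_chart], where the
    velocity at time [h] is the moving vector. The acceleration of [g] does not enter, hence
    independence of the curve. *)
Lemma is_hess_normsq (X : tangent m) :
  is_hess (normsq kappa J) X (2 * (kappa (TJ J X) (TJ J X) - @w m (tau X) X)).
Proof.
move=> g [e e0 sg] g0 vX.
pose y (t : R^o) : E := k (g t); pose u (t : R^o) : lie_algebra G := J (g t).
have sge t : `|t| < e -> @msmooth_at R (vect_manifold R^o) M g t.
  move=> te; apply: msmooth_on_at sg => //.
  rewrite (_ : [set t | _] = ball (0 : R) e); first exact: ball_open.
  by apply/seteqP; split=> s; rewrite /ball /= sub0r normrN.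
have gc : g @ (0 : R^o) --> g 0.
  by have := sge 0; rewrite normr0 => /(_ e0) [].
have ngood : \forall t \near (0 : R^o), `|t| < e /\ cdom k (g t).
  have n1 : \forall t \near (0 : R^o), cdom k (g t).
    by rewrite g0 in gc; exact: gc _ (near_cdom mk).
  apply: filterI n1; apply/nbhs_ballP; exists e => // t.
  by rewrite /ball /= sub0r normrN.
have su t : `|t| < e -> smooth_at u t.
  move=> te; apply: (@msmooth_at_coord R R^o (vect_manifold (lie_algebra G)) _ _
    (id_chart _)) => //.
  apply: (@msmooth_at_comp R (vect_manifold R^o) M (vect_manifold (lie_algebra G)) g J).
    exact: sge.
  exact: msmooth_at_J.
have sy t : `|t| < e -> cdom k (g t) -> smooth_at y t.
  by move=> te tk; apply: msmooth_at_coord => //; exact: sge.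
have du t : `|t| < e -> cdom k (g t) ->
    dirder u t 1 = dirder Jchart (y t) (dirder y t 1).
  move=> te tk; rewrite -dirder_comp//; last 2 first.
  - exact: sy.
  - by apply: smooth_at_Jchart; exact: cfun_cod.
  apply: dirder_near; have [gct _] := sge t te.
  have nk : \forall s \near t, cdom k (g s) := gct _ (near_cdom tk).
  by apply: filterS nk => s sk; rewrite /Jchart /y /= cfunK.
have e00 : `|0 : R| < e by rewrite normr0.
have g0k : cdom k (g 0) by rewrite g0.
have y0E : y 0 = y0 by rewrite /y g0.
have dyX : dirder y 0 1 = X.
  by move: vX; rewrite /velocity0 /mderiv g0.
have u0 : u 0 = sigma by rewrite /u g0.
have duX : dirder u 0 1 = TJ J X by rewrite du // dyX y0E.
pose D (t : R^o) : R^o := 2 * kappa (dirder u t 1) (u t).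
have dF t : `|t| < e -> is_dirder (normsq kappa J \o g : R^o -> R^o) t 1 (D t).
  move=> te; have dut := smooth_at_is_dirder (1 : R^o) (su t te).
  have := is_dirder_kappa kl kC kc dut dut.
  by rewrite [kappa (u t) _]kC -mulr2n -mulr_natl.
have sdu : smooth_at (fun t : R^o => dirder u t 1) 0.
  apply: (@smooth_at_comp _ R^o (R^o * R^o)%type _ (fun t => (t, 1 : R^o))
    (fun p => dirder u p.1 p.2)).
    by apply: smooth_at_pair; [exact: smooth_at_id|exact: smooth_at_cst].
  by apply: smooth_at_dirder => //; exact: su.
have sdy : smooth_at (fun t : R^o => dirder y t 1) 0.
  apply: (@smooth_at_comp _ R^o (R^o * R^o)%type _ (fun t => (t, 1 : R^o))
    (fun p => dirder y p.1 p.2)).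
    by apply: smooth_at_pair; [exact: smooth_at_id|exact: smooth_at_cst].
  by apply: smooth_at_dirder => //; exact: sy.
have at0 (F : tvsType R) (f : R^o -> F) : smooth_at f 0 -> f @ (0 : R)^' --> f 0.
  move=> /smooth_at_continuous fc.
  exact: cvg_trans (cvg_app _ (@cvg_within _ _ _ _)) fc.
have dD : is_dirder D 0 1 (2 * (kappa (TJ J X) (TJ J X) - @w m (tau X) X)).
  have dyc := at0 _ _ sdy; rewrite dyX in dyc.
  have c2 := cvg_momentum_chart (sy 0 e00 g0k) y0E dyc; rewrite dyX in c2.
  have duc := at0 _ _ sdu; rewrite /= duX in duc.
  have dqu := smooth_at_is_dirder (1 : R^o) (su 0 e00); rewrite duX in dqu.
  have c1 : (fun h : R => kappa (dirder u h 1)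
      (h^-1 *: (u (0 + h *: (1 : R^o)) - u 0)) : R^o) @ (0 : R)^' -->
      (kappa (TJ J X) (TJ J X) : R^o) by exact: cvg_kappa.
  have c12 : (fun h : R => (2 : R) *: ((kappa (dirder u h 1)
      (h^-1 *: (u (0 + h *: (1 : R^o)) - u 0)) : R^o) +
      h^-1 * kappa (dirder Jchart (y h) (dirder y h 1)) sigma) : R^o) @ (0 : R)^'
      --> ((2 : R) *: ((kappa (TJ J X) (TJ J X) : R^o) + - @w m (tau X) X) : R^o).
    by apply: (@tvs_cvgZ _ _ _ _ R^o); [exact: cvg_cst|exact: (@tvs_cvgD _ _ _ _ R^o)].
  refine (cvg_trans _ c12); apply: near_eq_cvg; near=> h.
  have [he hk] : `|h| < e /\ cdom k (g h).
    by near: h; apply: (@cvg_within _ (nbhs (0 : R))); exact: ngood.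
  rewrite -du // add0r [h *: (1 : R^o)]mulr1 /D duX u0.
  rewrite (_ : kappa (TJ J X) sigma = 0); last exact: (momentum_chart0 X).
  rewrite mulr0 subr0 (kappaZr kl kC) (kappaBr kl kC) -mulrDr subrK.
  by rewrite /GRing.scale /= mulrCA.
rewrite /derive1n /=; apply: derive1_is_dirder.
apply: is_dirder_near dD; apply: filterS ngood => t [te _].
by apply/esym/derive1_is_dirder; exact: dF.
Unshelve. all: by end_near. Qed.

(** [is_hess] only constrains [h] through existing curves, so a curve with velocity [X] is needed to
    pin down the value chosen by [xget]: a straight line in the chart. *)
Lemma hess_normsq (X : tangent m) :
  hess (normsq kappa J) X = 2 * (kappa (TJ J X) (TJ J X) - @w m (tau X) X).
Proof.
pose y (t : R^o) : E := y0 + t *: (X : E); pose g (t : R) : M := cinv k (y t).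
have sy t : smooth_at y t.
  by apply: smooth_atD; [exact: smooth_at_cst|exact: smooth_at_scale].
have yE : y 0 = y0 by rewrite /y scale0r addr0.
have yc : y @ (0 : R^o) --> y 0 by exact: smooth_at_continuous.
rewrite yE in yc.
have nk : \forall t \near (0 : R^o), ccod k (y t) by exact: yc _ (near_ccod y0k).
have g0 : g 0 = m by rewrite /g yE cfunK.
have /nbhs_ballP[e /= e0 ek] := nk.
have sg : @msmooth_on R (vect_manifold R^o) M [set t : R | `|t| < e] g.
  apply: msmooth_at_on => // t te.
  have tk : ccod k (y t) by apply: ek; rewrite /ball /= sub0r normrN.
  apply: (@msmooth_at_comp R (vect_manifold R^o) (vect_manifold E) M y (cinv k)).
    exact: msmooth_at_vect.
  exact: msmooth_at_cinv.
have vX : velocity0 g = X.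
  rewrite /velocity0 /mderiv g0 (@dirder_near _ _ _ _ y).
    apply: dirderE => //; rewrite -[Z in is_dirder _ _ _ Z]add0r.
    apply: is_dirderD; first exact: is_dirder_cst.
    rewrite -[Z in is_dirder _ _ _ Z](scale1r X).
    apply: (@is_dirder_linear _ _ _ (fun t : R^o => t *: (X : E))) => a t u.
    by rewrite scalerDl scalerA.
  by apply: filterS nk => t tk; rewrite /= cinvK.
rewrite /hess; case: xgetP => [h -> hh|/(_ _ (@is_hess_normsq X))//].
have ex : exists2 e : R, 0 < e &
    @msmooth_on R (vect_manifold R^o) M [set t : R | `|t| < e] g by exists e.
by rewrite -(hh g ex g0 vX) (is_hess_normsq ex g0 vX).
Qed.

Lemma TJ_linear : linear (@TJ R G M J m : E -> lie_algebra G).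
Proof.
exact: (@mderiv_linear R M (vect_manifold (lie_algebra G)) J m hG (msmooth_at_J m)).
Qed.

Lemma formDl (u v X : E) : @w m (u + v) X = @w m u X + @w m v X.
Proof. by have := form_linear wP (X : tangent m) 1 u v; rewrite scale1r mul1r. Qed.

Lemma formZl (a : R) (u X : E) : @w m (a *: u) X = a * @w m u X.
Proof.
have f0 : @w m 0 X = 0.
  have := form_linear wP (X : tangent m) (-1) 0 0.
  by rewrite scaler0 addr0 mulN1r addNr.
by have := form_linear wP (X : tangent m) a u 0; rewrite addr0 f0 addr0.
Qed.

Lemma hess2_normsq (X Y : tangent m) :
  2^-1 * hess2 (normsq kappa J) X Y = kappa (TJ J X) (TJ J Y) - @w m (tau X) Y.
Proof.
have tauD : tau (X + Y) = tau X + tau Y.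
  have := isotropy_linear hM expP actP m sigma 1 X Y.
  by rewrite !scale1r.
have TJD : TJ J (X + Y) = TJ J X + TJ J Y :> lie_algebra G.
  by have := TJ_linear 1 X Y; rewrite !scale1r.
have wXY : @w m (tau X + tau Y) (X + Y) =
    @w m (tau X) X + @w m (tau Y) Y + 2 * @w m (tau X) Y.
  (* Additivity in the second slot comes from the symmetry of w (tau -, -), which moves the sum to
     the first. *)
  have wr (Z : E) : @w m (tau Z) (X + Y) = @w m (tau Z) X + @w m (tau Z) Y.
    by rewrite (tau_sym (X + Y) Z) tauD formDl (tau_sym Z X) (tau_sym Z Y).
  by rewrite formDl (wr X) (wr Y) (tau_sym X Y); ring.
rewrite /hess2 (hess_normsq X) (hess_normsq Y) (hess_normsq (X + Y)) TJD tauD wXY.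
rewrite (kappaDl kl) !(kappaDr kl kC) (kC (TJ J Y) (TJ J X)).
move: (kappa _ _) (kappa _ _) (kappa _ _) (@w m _ _) (@w m _ _) (@w m _ _).
by move=> *; field.
Qed.

(** [w] is only assumed linear in its first argument, but
    [w (dot xi m) V = - kappa (TJ V) xi] is linear in [V]; expanding
    [w (dot xi m + a V) (dot xi m + a V) = 0] and letting [a] tend to [0] gives
    antisymmetry on fundamental vectors. *)
Lemma form_antisym_fund xi (V : E) : @w m V (dot xi m) = - @w m (dot xi m) V.
Proof.
pose X : E := dot xi m; have [_ mom] := JP.
have wX (Z : E) : @w m X Z = - kappa (TJ J (Z : tangent m)) xi.
  by apply/eqP; rewrite -addr_eq0; apply/eqP; exact: mom.
have wXD (a : R) : @w m X (X + a *: V) = a * @w m X V.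
  have := TJ_linear a V X; rewrite [a *: V + X]addrC !wX => ->.
  rewrite kappaDl // kappaZl // opprD mulrN -wX.
  by rewrite (form_alternating wP) addr0.
have wV (a : R) : a != 0 -> @w m V (X + a *: V) = - @w m X V.
  move=> a0; have := form_alternating wP (X + a *: V : tangent m).
  rewrite formDl formZl wXD -mulrDr => /eqP; rewrite mulf_eq0 (negbTE a0) /=.
  by rewrite addrC addr_eq0 => /eqP.
have XaV := @cvg_line R E X V.
have yc : (fun _ : R => y0) @ (0 : R)^' --> y0 by exact: cvg_cst.
have Vc : (fun _ : R => V) @ (0 : R)^' --> V by exact: cvg_cst.
have c1 : (fun a : R => W y0 V (X + a *: V) : R^o) @ (0 : R)^' -->
  (@w m V X : R^o) by exact: cvg_tensor_in_chart.
apply: (cvg_unique (@Rhausdorff R) c1).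
apply: cvg_near_cst; near=> a.
have a0 : a != 0 by near: a; exact: nbhs_dnbhs_neq.
by rewrite tensor_in_chart0 wV.
Unshelve. all: by end_near. Qed.

End Hessian.

(** Order 0 of [ac_smooth], restricted to the fibre over [m]; in the preferred chart at [m] the
    tangent maps of the chart and of its inverse are the identity there. *)
Lemma almost_complex_continuous (R : realType) (M : manifold R)
    (j : endo_field M) (m : M) : hausdorff_space (mmodel M) -> almost_complex j ->
  continuous (j m : mmodel M -> mmodel M).
Proof.
move=> hM jP v; pose k := chart_at m; pose E := mmodel M.
have ka : atlas k by exact: chart_at_atlas.
have mk : cdom k m by exact: chart_at_dom.
have y0k : ccod k (k m) by exact: cfun_cod.
have [+ _] := ac_smooth jP ka 0%N; move=> /(_ (k m, v) y0k).
set f := (f in {for _, continuous f}) => fc.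
have fE u : f (k m, u) = j m u.
  rewrite /f /= mderiv_cinv0//.
  have jE x (a : E) : x = m -> mderiv M (vect_manifold E) k x (j x a) = j m a :> E.
    move=> ->; rewrite /mderiv /= (@dirder_near _ _ _ _ id).
      exact: dirder_of_linear.
    by apply: filterS (near_ccod y0k) => y yk; rewrite /= cinvK.
  exact: jE (cfunK mk).
have vc : (fun u : E => (k m, u)) @ v --> (k m, v).
  have c1 : (fun _ : E => k m) @ v --> k m by exact: cvg_cst.
  by have := cvg_pair c1 (@cvg_id _ (nbhs v)); exact.
have fvc : (f \o (fun u : E => (k m, u))) @ v --> f (k m, v).
  exact: (cvg_comp _ _ vc fc).
have fj : f \o (fun u : E => (k m, u)) = j m by apply/funext => u; exact: fE.
by rewrite fE fj in fvc.
Qed.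

Theorem proposition4p11 (R : realType)
    (M : manifold R) (frechetM : frechet_manifold M)
    (connectedM : connected [set: M])
    (G : lie_group R) (frechetG : frechet_manifold G)
    (w : two_tensor M) (sympl : symplectic_form w)
    (act : G -> M -> M) (sympl_act : symplectic_action act w)
    (expG : lie_algebra G -> G) (exp_smooth : smooth_exponential expG)
    (kappa : lie_algebra G -> lie_algebra G -> R) (pair_kappa : pairing kappa)
    (J : M -> lie_algebra G) (momJ : momentum_map act expG w kappa J)
    (j : endo_field M) (acs_j : almost_complex j) (compat_j : compatible w j)
    (m : M) (crit_m : critical (normsq kappa J) m)
    (stab_lie : lie_subgroup (stabilizer act m))
    (isotropy_mom : exists Jhat : tangent m -> lie_algebra G,
       isotropy_momentum_map act expG w kappa Jhat)
    (adstar : lie_algebra G -> lie_algebra G -> lie_algebra G)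
    (adstarP : ad_adjoint kappa adstar)
    (Sigma_kappa : exists S : lie_algebra G -> lie_algebra G,
       forall xi eta, kappa (S xi) eta = cocycle act expG w kappa J m xi eta) :
  let dot (xi : lie_algebra G) : tangent m := fund act expG xi m in
  let H (X Y : tangent m) : R := hess2 (normsq kappa J) X Y in
  let L : lie_algebra G -> lie_algebra G := Lop act expG J j m in
  let Z : lie_algebra G -> lie_algebra G := Zop act expG J m in
  let adJ : lie_algebra G -> lie_algebra G := ad (J m) in
  let tau' (X : tangent m) : tangent m := tau_acs' act expG j (J m) X in
  let adJZ (xi : lie_algebra G) : lie_algebra G := adJ xi + Z xi in
  let Rop := opmx (@op0 R (lie_algebra G)) (fun xi => - adJ xi) adJZ L in
  let P := opmx (@op0 R (lie_algebra G)) (@op0 R _) (@op0 R _) id in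
  [/\ (forall xi eta,
         [/\ 2^-1 * H (dot xi) (dot eta) = - kappa xi (Z (adJZ eta)),
             2^-1 * H (dot xi) (j m (dot eta)) =
               kappa xi (adstar (J m) (L eta) - Z (L eta)) &
             2^-1 * H (j m (dot xi)) (j m (dot eta)) =
               kappa xi (L (L eta) - Z (adJ eta)) +
               kappa (TJ J (j m (tau' (dot eta)))) xi]),
      ((forall X : tangent m, tau' X = 0) ->
         forall zeta gamma : lie_algebra G * lie_algebra G,
           2^-1 * H (cfund act expG j zeta m) (cfund act expG j gamma m) =
           complex.Re (csesqui kappa zeta (Cplus L Z (Rop gamma)))),
      (forall gamma, Rop gamma = Cminus L Z (P gamma) + imul (cext adJZ gamma)) &
      (ad_equivariant act expG J ->
         forall gamma, Rop gamma = Cminus L Z (P gamma))].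
Proof.
have hM : hausdorff_space (mmodel M) by case: frechetM => _ [].
have hG : hausdorff_space (mmodel G) by case: frechetG => _ [].
have [actP _] := sympl_act.
have sm := critical_fixed sympl pair_kappa momJ crit_m.
have kl v : scalar (kappa ^~ v) by case: pair_kappa => + _ _ _; exact.
have kC u v : kappa u v = kappa v u by case: pair_kappa.
move=> dot H L Z adJ tau' adJZ Rop P.
pose E := mmodel M; pose T (X : E) : lie_algebra G := TJ J (X : tangent m).
pose J1 (X : E) : E := j m X; pose tau : E -> E := isotropy expG act m (J m).
have [_ mom] := momJ.
have wfund xi (V : E) : @w m (dot xi) V = - kappa (T V) xi.
  by apply/eqP; rewrite -addr_eq0; apply/eqP; exact: mom.
have Tl : linear T by exact: (TJ_linear hG momJ m).
have dl : linear (dot : lie_algebra G -> E) by exact: (fund_linear hM exp_smooth actP m).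
have jl : linear J1 by exact: ac_linear.
have tl : linear tau by exact: (isotropy_linear hM exp_smooth actP).
have linD (U V : lmodType R) (f : U -> V) : linear f -> forall x y, f (x + y) = f x + f y.
  by move=> lf x y; have := lf 1 x y; rewrite !scale1r.
have lin0 (U V : lmodType R) (f : U -> V) : linear f -> f 0 = 0.
  by move=> lf; have := lf (-1) 0 0; rewrite scaler0 addr0 scaleN1r addNr.
have linN (U V : lmodType R) (f : U -> V) : linear f -> forall x, f (- x) = - f x.
  by move=> lf x; have := lf (-1) x 0; rewrite (lin0 _ _ _ lf) !addr0 !scaleN1r.
have Zl : linear Z by move=> a x y; rewrite /Z /Zop -/(dot _) dl; exact: Tl.
have Ll : linear L.
  move=> a x y; rewrite /L /Lop -/(dot _) dl.
  have -> : j m (a *: (dot x : E) + dot y) = a *: J1 (dot x) + J1 (dot y) by exact: jl.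
  exact: Tl.
have taudot xi : tau (dot xi) = dot (adJ xi) by exact: isotropy_fund.
have wanti xi (V : E) : @w m V (dot xi) = - @w m (dot xi) V.
  exact: (form_antisym_fund hG hM sympl pair_kappa momJ).
have wN (u V : E) : @w m (- u) V = - @w m u V.
  by rewrite -scaleN1r (formZl sympl) mulN1r.
have J1J1 V : J1 (J1 V) = - V by exact: ac_square.
(* Apply [j] to both slots. The sign from the square of [j] is carried inside [dot], so that the
   second slot is again a fundamental vector and [wanti] applies. *)
have wj xi (V : E) : @w m V (J1 (dot xi)) = @w m (dot xi) (J1 V).
  have [cw _] := compat_j.
  rewrite -(cw m V) -/(J1 _) -/(J1 _) J1J1 -(linN _ _ _ dl) wanti (linN _ _ _ dl).
  by rewrite wN opprK.
have FE (X Y : E) : 2^-1 * H X Y = kappa (T X) (T Y) - @w m (tau X) Y.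
  exact: (hess2_normsq hG hM exp_smooth actP sympl pair_kappa momJ sm).
have wtau (X Y : E) : @w m (tau Y) X = @w m (tau X) Y.
  exact: (tau_sym hG hM exp_smooth actP sympl pair_kappa momJ sm).
(* [kappa (Z xi) eta] is - w (eta . m, xi . m); likewise [kappa (L xi) eta] is - w (eta . m, j (xi .
   m)), whose symmetry is [wj]. *)
have Zanti xi eta : kappa (Z xi) eta = - kappa xi (Z eta).
  rewrite (kC xi); have := wanti eta (dot xi); rewrite !wfund opprK => /esym.
  exact.
have Lsym xi eta : kappa (L xi) eta = kappa xi (L eta).
  rewrite (kC xi); have := wj eta (dot xi); rewrite !wfund => /oppr_inj/esym.
  exact.
have tau'E (X : E) : tau' X = tau (J1 X) - J1 (tau X).
  apply: (tau_acs'E hM exp_smooth actP sm) => //.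
  exact: almost_complex_continuous.
have F1 xi eta : 2^-1 * H (dot xi) (dot eta) = - kappa xi (Z (adJZ eta)).
  rewrite FE -wtau taudot wfund opprK -(kappaDr kl kC) -Zanti.
  by rewrite [T (dot eta) + _]addrC.
(* Here [tau] is left on xi . m, since on j (eta . m) it would produce tau'; the adjoint then frees
   [xi] from [adJ]. *)
have F2 xi eta : 2^-1 * H (dot xi) (j m (dot eta)) =
    kappa xi (adstar (J m) (L eta) - Z (L eta)).
  rewrite FE taudot wfund opprK (kappaBr kl kC) [kappa xi (adstar _ _)]kC adstarP.
  by rewrite -Zanti addrC.
have F3 xi eta : 2^-1 * H (j m (dot xi)) (j m (dot eta)) =
    kappa xi (L (L eta) - Z (adJ eta)) + kappa (TJ J (j m (tau' (dot eta)))) xi.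
  rewrite FE -wtau.
  (* Now both vectors carry [j]; commuting [tau] past it leaves the defect tau'. *)
  have -> : tau (J1 (dot eta)) = tau' (dot eta) + J1 (dot (adJ eta)).
    by rewrite tau'E taudot subrK.
  rewrite -[j m (dot xi)]/(J1 _) wj wfund opprK (linD _ _ _ jl) J1J1 (linD _ _ _ Tl).
  rewrite (linN _ _ _ Tl) (kappaBl kl) (kappaBr kl kC).
  have -> : kappa (T (J1 (dot xi))) (T (J1 (dot eta))) = kappa xi (L (L eta)).
    exact: Lsym xi (L eta).
  have -> : kappa (T (dot (adJ eta))) xi = kappa xi (Z (adJ eta)) by exact: kC.
  by rewrite [kappa (T _) xi - _]addrC addrA.
have L0 : L 0 = 0 by exact: lin0 Ll.
have Z0 : Z 0 = 0 by exact: lin0 Zl.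
(* In the first component the term [Z g2] from [Cminus] cancels against the one in [- adJZ g2]. *)
have Rdecomp gamma : Rop gamma = Cminus L Z (P gamma) + imul (cext adJZ gamma).
  case: gamma => g1 g2; rewrite [RHS]surjective_pairing.
  rewrite /Rop /Cminus /P /cext /imul /opmx /op0 /= !(add0r, addr0) L0 Z0.
  congr (_, _); last by rewrite oppr0 addr0 addrC.
  by rewrite !opprD opprK add0r addrCA subrr addr0.
split=> //.
- move=> tau0 [z1 z2] [g1 g2].
  (* By symmetry [tau] passes from xi . m to j (eta . m), and there it commutes with [j] by
     invariance. *)
  have adL xi eta : kappa xi (adstar (J m) (L eta)) = - kappa xi (L (adJ eta)).
    rewrite kC adstarP (kC xi).
    have : @w m (dot (adJ xi)) (J1 (dot eta)) = - @w m (dot xi) (J1 (dot (adJ eta))).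
      rewrite -taudot wtau; have := tau'E (dot eta).
      rewrite tau0 => /esym/eqP; rewrite subr_eq0 => /eqP ->.
      by rewrite taudot wanti.
    by rewrite !wfund opprK => <-; rewrite opprK.
  have wr (U X Y : E) : @w m (tau U) (X + Y) = @w m (tau U) X + @w m (tau U) Y.
    by rewrite (wtau (X + Y) U) (linD _ _ _ tl) (formDl sympl) (wtau U X) (wtau U Y).
  (* The cross term in [Y] and [X'] is transposed, so that [j] sits in the second argument as [F2]
     requires; [e1] and [e2] bring it back to the form [kappa z2 _]. *)
  have FD (X Y X' Y' : E) : 2^-1 * H (X + Y) (X' + Y') =
      2^-1 * H X X' + 2^-1 * H X Y' + (2^-1 * H X' Y + 2^-1 * H Y Y').
    rewrite !FE !(linD _ _ _ Tl) (linD _ _ _ tl) (formDl sympl) (wr X) (wr Y).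
    rewrite (kappaDl kl) !(kappaDr kl kC) (kC (T X') (T Y)) (wtau Y X').
    move: (kappa _ _) (kappa _ _) (kappa _ _) (kappa _ _).
    move: (@w m _ _) (@w m _ _) (@w m _ _) (@w m _ _).
    by move=> *; ring.
  have e1 : kappa g1 (adstar (J m) (L z2)) = kappa z2 (L (adJ g1)).
    by rewrite kC adstarP Lsym.
  have e2 : kappa g1 (Z (L z2)) = - kappa z2 (L (Z g1)).
    by rewrite -Lsym kC -(opprK (kappa (Z _) _)) Zanti opprK kC.
  have e3 : Cplus L Z (Rop (g1, g2)) =
      (- (L (adJ g2)) - (Z (adJZ g1) + Z (L g2)),
       L (adJ g1) + L (Z g1) + L (L g2) - Z (adJ g2)).
    rewrite [LHS]surjective_pairing /Cplus /Rop /cext /imul /opmx /op0 /=.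
    rewrite !(add0r, addr0) (linN _ _ _ Ll) (linN _ _ _ Zl) !(linD _ _ _ Zl).
    by rewrite (linD _ _ _ Ll (adJZ g1)) (linD _ _ _ Ll (adJ g1)).
  have -> : 2^-1 * H (cfund act expG j (z1, z2) m) (cfund act expG j (g1, g2) m) =
      2^-1 * H (dot z1) (dot g1) + 2^-1 * H (dot z1) (j m (dot g2)) +
      (2^-1 * H (dot g1) (j m (dot z2)) + 2^-1 * H (j m (dot z2)) (j m (dot g2))).
    exact: FD.
  rewrite F1 F2 F2 F3 tau0.
  have -> : TJ J (j m 0) = 0.
    by have := lin0 _ _ _ Tl; rewrite -{1}(lin0 _ _ _ jl).
  have -> : kappa 0 z2 = 0 by rewrite -(scale0r 0) (kappaZl kl) mul0r.
  rewrite e3 /csesqui /=; clear -kl kC adL e1 e2; clearbody L Z adJZ adJ.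
  rewrite !(kappaBr kl kC) e1 e2 adL !(kappaDr kl kC) (kappaNr kl kC).
  by ring.
- move=> equi gamma; rewrite Rdecomp.
  suff -> : imul (cext adJZ gamma) = 0 by rewrite addr0.
  (* Equivariance gives [Z xi = ad xi (J m)], which is [- adJ xi] by antisymmetry of the bracket. *)
  have adJZ0 xi : adJZ xi = 0.
    rewrite /adJZ /Z /Zop equi (ad_antisym hG exp_smooth xi).
    by rewrite subrr.
  by rewrite /imul /cext /opmx /op0 /= !adJZ0; congr (_, _); rewrite ?addr0 ?oppr0.
Qed.
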